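(* For every real $x>1$, $$\left|\sqrt{U_{\mathcal M}(x)}-\sqrt{\log_4 x}\right|\le 2\min\left\{1,\ \frac{2\ln(\mathrm e+\ln x)}{\sqrt{\ln x}}\right\},$$ where $U_{\mathcal M}$ is the optimal adjustment function of the class $\mathcal M$ of randomised monotone functions (defined in the context).
   Context: **Randomised functions.** Let $n\ge 1$, let $\mathcal Z_1,\dots,\mathcal Z_n$ be measurable spaces with product $\mathcal Z=\prod_{i=1}^n\mathcal Z_i$, let $\Theta$ be a non-empty index set, and let $f\colon\mathcal Z\times\Theta\to\mathbb R$ be bounded and such that for every $\theta\in\Theta$ the section $f_\theta(z):=f(z,\theta)$ is measurable in $z$. Write $f_z(\theta):=f(z,\theta)$. For a random vector $Z=(Z_1,\dots,Z_n)$ with independent components, $Z_i$ taking values in $\mathcal Z_i$, the random map $f_Z\colon\Theta\to\mathbb R$ is called a randomised function, and $(f,Z)$ a randomisation. **Effective sample size.** Put $c_i(f):=\sup_{\theta\in\Theta,\,z_i^*\in\mathcal Z_i,\,z\in\mathcal Z}|f_\theta(z_i^*,z_{-i})-f_\theta(z)|$, where $(z_i^*,z_{-i})$ is $z$ with its $i$-th coordinate replaced by $z_i^*$, and $\eta_f:=\left(\sum_{i=1}^n c_i(f)^2\right)^{-1}\in(0,\infty]$ (with $1/0=\infty$). **The class $\mathcal M$.** $\mathsf M$ is the set of non-decreasing functions $\mathbb R\to[0,1]$. $\mathcal M$ is the class of all randomisations $(f,Z)$ with index set $\Theta=\mathbb R$ (ranging over all finite products of measurable spaces) such that $f_z\in\mathsf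 M$ for every $z\in\mathcal Z$; one writes $f_Z\in\mathcal M$. **The function $U_{\mathcal M}$.** $\mathbb R_+=[0,\infty)$. $U_{\mathcal M}\colon\mathbb R_+\to\mathbb R_+$ is the (pointwise) infimum of all functions $U\colon\mathbb R_+\to\mathbb R_+$ such that, for every $f_Z\in\mathcal M$ with $\eta_f<\infty$, $$\mathbb P\left\{\sqrt{\eta_f}\,\sup_{t\in\mathbb R}|f_Z(t)-\mathbb E[f_Z(t)]|\ge\varepsilon\sqrt{U(\eta_f)}\right\}\le 2\mathrm e^{-2\varepsilon^2}\quad\text{for all }\varepsilon>0.$$ (The supremum is measurable for $f_Z\in\mathcal M$.) $\ln$ is the natural logarithm and $\log_4 x=\ln x/\ln 4$. *)

(* Defs.v *)
From HB Require Import structures.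
From mathcomp Require Import all_boot all_order all_algebra.
From mathcomp Require Import all_classical all_reals all_analysis.

Set Implicit Arguments.
Unset Strict Implicit.
Unset Printing Implicit Defensive.

Import Order.TTheory GRing.Theory Num.Theory.
Import numFieldNormedType.Exports.

Local Open Scope classical_set_scope.
Local Open Scope ring_scope.

(* The library has only the binary product and tuples over a single measurable
   space, hence this generating family of the product sigma-algebra. *)
Definition cylinders (n : nat) (d : 'I_n -> measure_display)
    (T : forall i, measurableType (d i)) : set (set (forall i, T i)) :=
  [set C | exists (i : 'I_n) (A : set (T i)),
     measurable A /\ C = (fun z : forall i, T i => z i) @^-1` A].
Arguments cylinders {n d} T.

Definition independent_components (R : realType) (dO : measure_display)
    (Omega : measurableType dO) (P : probability Omega R) (n : nat)
    (d : 'I_n -> measure_display) (T : forall i, measurableType (d i))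
    (Z : forall i, Omega -> T i) : Prop :=
  forall (J : {set 'I_n}) (A : forall i, set (T i)),
    (forall i, measurable (A i)) ->
    P (\bigcap_(i in [set` J]) (Z i @^-1` A i)) =
    (\prod_(i in J) P (Z i @^-1` A i))%E.

Record randomisation (R : realType) (Theta : Type) := Randomisation {
  index_nonempty : [set: Theta] !=set0 ;
  dimn : nat ;
  dimn_gt0 : (0 < dimn)%N ;
  disp : 'I_dimn -> measure_display ;
  coord : forall i, measurableType (disp i) ;
  rfun : (forall i, coord i) -> Theta -> R ;
  rfun_bounded : exists K : R, forall z theta, `|rfun z theta| <= K ;
  rfun_measurable : forall theta, measurable_fun setT
    ((fun z => rfun z theta) : g_sigma_algebraType (cylinders coord) -> R) ;
  dispO : measure_display ;
  Omega : measurableType dispO ;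
  prob : probability Omega R ;
  rvec : forall i, {mfun Omega >-> coord i} ;
  rvec_indep : independent_components prob (fun i => rvec i : Omega -> coord i)
}.
Arguments coord {R Theta} r i.
Arguments rfun {R Theta} r _ _.
Arguments Omega {R Theta} r.
Arguments prob {R Theta} r.
Arguments rvec {R Theta} r i.

Definition random_fun (R : realType) (Theta : Type) (r : randomisation R Theta)
    (theta : Theta) (w : Omega r) : R :=
  rfun r (fun i => rvec r i w) theta.
Arguments random_fun {R Theta} r theta w.

Definition coord_osc (R : realType) (Theta : Type) (r : randomisation R Theta)
    (i : 'I_(dimn r)) : R :=
  sup [set y | exists (theta : Theta) (zi : coord r i)
                      (z : forall j, coord r j),
         y = `|rfun r (dfwith z i zi) theta - rfun r z theta|].
Arguments coord_osc {R Theta} r i.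

(* The inverse is the one of \bar R, for which 0^-1 = +oo. *)
Definition eff_size (R : realType) (Theta : Type) (r : randomisation R Theta) : \bar R :=
  (((\sum_(i < dimn r) coord_osc r i ^+ 2)%:E)^-1)%E.

Definition monotone_class (R : realType) : set (R -> R) :=
  [set g | {homo g : s t / s <= t} /\ (forall t, 0 <= g t <= 1)].

Definition randomised_monotone (R : realType) (r : randomisation R R) : Prop :=
  forall z, monotone_class (rfun r z).

Definition sup_deviation (R : realType) (Theta : Type) (r : randomisation R Theta)
    (w : Omega r) : R :=
  sup [set `|random_fun r theta w - fine 'E_(prob r)[random_fun r theta]|
      | theta in [set: Theta]].
Arguments sup_deviation {R Theta} r w.

(* Functions on the nonnegative half-line are represented by functions on R
   whose values at negative arguments are irrelevant. *)
Definition adjustment (R : realType) : set (R -> R) :=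
  [set U | (forall x, 0 <= x -> 0 <= U x) /\
    forall r : randomisation R R, randomised_monotone r ->
      (eff_size r < +oo)%E ->
      forall eps : R, 0 < eps ->
        (prob r [set w | (eps * Num.sqrt (U (fine (eff_size r))) <=
                          Num.sqrt (fine (eff_size r)) * sup_deviation r w)%R]
         <= (2 * expR (- 2 * eps ^+ 2))%:E)%E].

(* The real infimum of the empty set is 0, so if there were no adjustment
   function at all, opt_adjustment would vanish identically. *)
Definition opt_adjustment (R : realType) (x : R) : R := inf [set U x | U in @adjustment R].

Definition log4 (R : realType) (x : R) : R := ln x / ln 4.

(* Main.v *)
Require Import Defs.
From HB Require Import structures.
From mathcomp Require Import all_boot all_order all_algebra.
From mathcomp Require Import all_classical all_reals all_analysis.
From mathcomp Require Import measurable_realfun.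
From mathcomp Require Import lra zify.
Import Order.TTheory GRing.Theory Num.Theory.
Import numFieldNormedType.Exports.
Import Defs.

Set Implicit Arguments.
Unset Strict Implicit.
Unset Printing Implicit Defensive.

Local Open Scope classical_set_scope.
Local Open Scope ring_scope.

(** Upper bound.  McDiarmid's inequality holds for each [f_Z(t)]: replacing the
    coordinates one after the other by their averages, Hoeffding's lemma
    controls each replacement.  The mean function takes values in [0, 1]; on
    each of [K] levels where it oscillates by at most [delta] the events
    [f_Z(t) - E f_Z(t) >= s] are essentially nested in [t] by monotonicity, so
    that [2 K] tail bounds suffice for the supremum.  The requirements on an
    adjustment function at different values of [eta] do not interact, hence it
    is enough to treat [eta = x].  With [K] of order [sqrt (x U)], the factor
    [K] is absorbed by [U] close to [log_4 x], because
    [ln (sqrt x) = ln 2 * log_4 x] and only [eps ^ 2 > ln 2 / 2] matters.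

    Lower bound.  For a step function with [N] steps, the [j]-th at height
    [n c j] plus [c] times an independent fair binomial count of [n] votes, one has
    [eta = 1 / (n c ^ 2)], and the constraint [N n c <= 1] amounts to
    [N ^ 2 n <= eta].  By a lower bound on binomial tails some step deviates
    from its mean with probability close to 1 by about
    [sqrt (ln N / (2 eta))], while the required bound is below 1 as soon as
    [eps ^ 2 > ln 2 / 2]; comparing the two forces [U] to be at least about
    [ln N / ln 2], and this is close to [log_4 x] for [N] close to [sqrt x]. *)

(** * Hoeffding's lemma *)

Section scalar.
Context {R : realType}.
Implicit Types p h u x : R.

Lemma ge0_derive_ge0 (f df : R -> R) :
  (forall x, 0 <= x -> is_derive x 1 f (df x)) ->
  (forall x, 0 <= x -> 0 <= df x) -> 0 <= f 0 ->
  forall x, 0 <= x -> 0 <= f x.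
Proof.
move=> fE df0 f0 x x0.
have [||c] := @MVT_segment R f df 0 x x0.
- by move=> y; rewrite in_itv/= => /andP[/ltW y0 _]; exact: fE.
- apply: derivable_within_continuous => y; rewrite in_itv/= => /andP[y0 _].
  by have [] := fE _ y0.
rewrite in_itv/= subr0 => /andP[c0 _] fx.
by rewrite -(subrK (f 0) (f x)) addr_ge0// fx mulr_ge0// df0.
Qed.

(** The logarithm of the left-hand side has derivative [u] in [h], and [u' = u * (1 - u) <= 1 / 4].
    Integrating twice from [u 0 = p] gives the quadratic exponent. *)
Lemma hoeffding_scalar_pos p h : 0 <= p <= 1 -> 0 <= h ->
  1 - p + p * expR h <= expR (p * h + h ^+ 2 / 8).
Proof.
move=> /andP[p0 p1] h0.
pose D x : R := 1 - p + p * expR x.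
have D1 x : 0 <= x -> 1 <= D x.
  move=> x0; rewrite /D -[leLHS](subrK p) lerD2l ler_peMr//.
  by rewrite (le_trans _ (expR_ge1Dx x))// lerDl.
have D0 x : 0 <= x -> 0 < D x by move=> x0; rewrite (lt_le_trans _ (D1 _ x0)).
have dD x : is_derive x 1 D (p * expR x).
  rewrite /D; apply: is_derive_eq.
  by rewrite /GRing.scale/=; lra.
pose u x := p * expR x / D x.
have du x : 0 <= x -> is_derive x 1 u (u x * (1 - u x)).
  move=> x0.
  have Dx : D x != 0 by rewrite gt_eqF// D0.
  have dDx := dD x.
  have dV : is_derive x 1 (fun x => (D x)^-1) (- (D x) ^- 2 *: (p * expR x)).
    exact: is_deriveV.
  have dp : is_derive x 1 (fun x => p * expR x) (p * expR x).
    by apply: is_derive_eq; rewrite /GRing.scale/=; lra.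
  apply: (@is_derive_eq _ _ _ _ _ _ _ _ (is_deriveM dp dV)).
  rewrite /u /GRing.scale/= expr2 invfM; have := mulfV Dx; set v := (D x)^-1.
  by nra.
have u_le x : 0 <= x -> u x <= p + x / 4.
  move=> x0; rewrite -subr_ge0.
  apply: (@ge0_derive_ge0 (fun x => p + x / 4 - u x)
    (fun x => 4^-1 - u x * (1 - u x))) x0.
  - move=> y y0; have duy := du y y0; apply: is_derive_eq.
    by rewrite /GRing.scale/=; lra.
  - move=> y y0; have := sqr_ge0 (2^-1 - u y); nra.
  - rewrite /u /D expR0; rewrite mulr1 subrK divr1 mul0r addr0 subrr.
    by [].
rewrite -[leLHS]lnK ?posrE ?D0// ler_expR.
rewrite -subr_ge0.
apply: (@ge0_derive_ge0 (fun x => p * x + x ^+ 2 / 8 - ln (D x))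
  (fun x => p + x / 4 - u x)) h0.
- move=> y y0; have dl := is_derive1_ln (D0 _ y0).
  have := @is_derive1_comp R (@ln R) D y _ _ dl (dD y) => dln.
  apply: is_derive_eq.
  by rewrite /u /GRing.scale/=; lra.
- by move=> y y0; rewrite subr_ge0 u_le.
- rewrite /D expR0 mulr1 subrK ln1 mulr0 expr0n/= mul0r !addr0 subr0; by [].
Qed.

Lemma hoeffding_scalar p h : 0 <= p <= 1 ->
  1 - p + p * expR h <= expR (p * h + h ^+ 2 / 8).
Proof.
move=> p01; have [h0|h0] := leP 0 h; first exact: hoeffding_scalar_pos.
(* Factoring out [expR h] exchanges [p] with [1 - p] and [h] with [- h]. *)
have /hoeffding_scalar_pos : 0 <= 1 - p <= 1 by lra.
move=> /(_ (- h)); rewrite oppr_ge0 ltW// => /(_ isT) H.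
have -> : 1 - p + p * expR h = expR h * (1 - (1 - p) + (1 - p) * expR (- h)).
  by rewrite subKr mulrDr mulrCA -expRD subrr expR0 mulr1 addrC [expR h * p]mulrC.
apply: (le_trans (ler_wpM2l (expR_ge0 h) H)).
rewrite -expRD ler_expR le_eqVlt; apply/orP; left; apply/eqP; lra.
Qed.

(** Convexity, read off the tangent of [expR] at [p * h]: it bounds [expR] from below at [h] and at
    [0], and the weights [p] and [1 - p] cancel its slope. *)
Lemma chord_expR (p h : R) : 0 <= p <= 1 -> expR (p * h) <= 1 - p + p * expR h.
Proof.
move=> /andP[p0 p1].
have a0 := expR_gt0 (p * h).
have e1 : expR h = expR (p * h) * expR ((1 - p) * h).
  by rewrite -expRD; congr expR; lra.
have e2 : 1 = expR (p * h) * expR (- (p * h)) by rewrite -expRD subrr expR0.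
have h1 := expR_ge1Dx ((1 - p) * h); have h2 := expR_ge1Dx (- (p * h)).
have h3 : expR (p * h) * (1 + (1 - p) * h) <= expR h by rewrite e1 ler_pM2l.
have h4 : expR (p * h) * (1 - p * h) <= 1 by rewrite {2}e2 ler_pM2l.
have h5 := ler_wpM2l p0 h3.
have h6 : (1 - p) * (expR (p * h) * (1 - p * h)) <= 1 - p.
  by rewrite -[leRHS]mulr1 ler_wpM2l// subr_ge0.
by lra.
Qed.

(** With [u = expR t] this is [t <= sinh t], which is sharper near [u = 1] than [ln u <= u - 1]. *)
Lemma ln_le_half_sub_inv u : 1 <= u -> ln u <= (u - u^-1) / 2.
Proof.
move=> u1.
have u0 : 0 < u by lra.
have l0 : 0 <= ln u by rewrite ln_ge0.
suff H : 0 <= expR (ln u) - expR (- ln u) - 2 * ln u.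
  by move: H; rewrite expRN lnK ?posrE//; lra.
apply: (@ge0_derive_ge0 (fun x => expR x - expR (- x) - 2 * x)
  (fun x => expR x + expR (- x) - 2)) l0.
- move=> y y0.
  apply: is_derive_eq.
  by rewrite /GRing.scale/=; lra.
- move=> y y0; have := expR_ge1Dx y; have := expR_ge1Dx (- y); lra.
- by rewrite oppr0 subrr mulr0 subrr.
Qed.

End scalar.

(** * Bounded random variables and their moment generating functions *)

Section bounded_integral.
Context {R : realType} d (Omega : measurableType d) (P : probability Omega R).
Implicit Types X Y : Omega -> R.

Lemma bounded_integrable (K : R) X : measurable_fun setT X ->
  (forall w, `|X w| <= K) -> P.-integrable setT (EFin \o X).
Proof.
move=> mX XK; apply: measurable_bounded_integrable => //.
  by rewrite (le_lt_trans (probability_le1 P measurableT))// ltry.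
exists K; split; first exact: num_real.
by move=> M KM w _; apply: le_trans (XK w) _; exact: ltW.
Qed.

Lemma Rintegral_probability_cst (c : R) : \int[P]_w c = c.
Proof.
rewrite Rintegral_cst//; transitivity (c * 1); last by rewrite mulr1.
exact: (congr1 (fun x => c * fine x) (probability_setT P)).
Qed.

Lemma bounded_Rintegral_norm_le (K : R) X : measurable_fun setT X ->
  (forall w, `|X w| <= K) -> `|\int[P]_w X w| <= K.
Proof.
move=> mX XK; have iX := bounded_integrable mX XK.
apply: (le_trans (le_normr_Rintegral measurableT iX)).
rewrite -[leRHS]Rintegral_probability_cst; apply: le_Rintegral => //.
- by apply: (@bounded_integrable K); [exact: measurableT_comp|move=> w; rewrite normr_id].
- by apply: (@bounded_integrable `|K|).
Qed.

Lemma measurable_set_ge X (a : R) : measurable_fun setT X ->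
  measurable [set w | a <= X w].
Proof.
move=> mX; have := mX measurableT `[a, +oo[%classic (measurable_itv _).
by rewrite setTI preimage_itvcy.
Qed.

Lemma measurable_set_gt X (a : R) : measurable_fun setT X ->
  measurable [set w | a < X w].
Proof.
move=> mX; have := mX measurableT `]a, +oo[%classic (measurable_itv _).
by rewrite setTI preimage_itvoy.
Qed.

Lemma measurable_set_le X (a : R) : measurable_fun setT X ->
  measurable [set w | X w <= a].
Proof.
move=> mX; have := mX measurableT `]-oo, a]%classic (measurable_itv _).
by rewrite setTI preimage_itvNyc.
Qed.

(** [Y] ranges in an interval [[lo, lo + c]], on which the chord dominates the exponential. The
    integral of this affine bound depends only on the mean of [Y], and [hoeffding_scalar]
    concludes. *)
Lemma hoeffding_mgf (c l : R) Y : measurable_fun setT Y ->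
  (forall w w', `|Y w - Y w'| <= c) ->
  \int[P]_w expR (l * Y w) <= expR (l * \int[P]_w Y w + l ^+ 2 * c ^+ 2 / 8).
Proof.
move=> mY Yc.
have [w0 _] : [set: Omega] !=set0.
  apply/set0P/negP => /eqP T0; have := probability_setT P.
  by rewrite T0 measure0 => /eqP; rewrite eq_sym onee_eq0.
pose lo := inf (range Y).
have hlo : has_inf (range Y).
  split; first by exists (Y w0), w0.
  by exists (Y w0 - c) => _ [w _ <-]; have := Yc w0 w; rewrite ler_norml; lra.
have loY w : lo <= Y w by apply: ge_inf; [exact: hlo.2 | exists w].
have Ylo w : Y w <= lo + c.
  rewrite -lerBlDr; apply: lb_le_inf; first exact: hlo.1.
  by move=> _ [w' _ <-]; have := Yc w w'; rewrite ler_norml; lra.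
pose K : R := `|lo| + `|c|.
have YK w : `|Y w| <= K.
  have := loY w; have := Ylo w; rewrite /K.
  have := ler_norm c; have := ler_norm lo; have := ler_norm (- lo); rewrite normrN.
  by rewrite ler_norml; lra.
have iY := bounded_integrable mY YK.
have icst (k : R) : P.-integrable setT (EFin \o (fun=> k)).
  by apply: (@bounded_integrable `|k|).
(* A constant [Y] is set apart, since the normalisation below divides by [c]. *)
have [c0|c0] := eqVneq c 0.
  have YE w : Y w = lo by apply/eqP; rewrite eq_le loY -[leRHS]addr0 -c0 Ylo.
  under eq_Rintegral do rewrite YE.
  under [in leRHS]eq_Rintegral do rewrite YE.
  by rewrite !Rintegral_probability_cst c0 expr0n/= mulr0 mul0r addr0.
have {}c0 : 0 < c by rewrite lt_neqAle eq_sym c0/= (le_trans _ (Yc w0 w0)).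
pose p w := (Y w - lo) / c.
have p01 w : 0 <= p w <= 1.
  rewrite /p; apply/andP; split; first by rewrite divr_ge0 ?subr_ge0// ltW.
  by rewrite ler_pdivrMr// mul1r lerBlDl.
have ptE w : l * Y w = l * lo + p w * (l * c).
  have -> : p w * (l * c) = l * (Y w - lo) * (c * c^-1) by rewrite /p; lra.
  by rewrite mulfV ?gt_eqF//; lra.
pose a := expR (l * lo); pose b := expR (l * c) - 1.
pose q := (\int[P]_w Y w - lo) / c.
have key w : expR (l * Y w) <= a * (1 + b * p w).
  rewrite ptE expRD ler_pM2l ?expR_gt0// (le_trans (chord_expR _ (p01 w)))//.
  by rewrite /b; lra.
have mp : measurable_fun setT p.
  by apply: measurable_funM => //; exact: measurable_funB.
have ip : P.-integrable setT (EFin \o p).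
  by apply: (@bounded_integrable 1) => // w; rewrite ger0_norm; case/andP: (p01 w).
have pq : \int[P]_w p w = q.
  rewrite /p RintegralZr//; last first.
    apply: (@bounded_integrable (K + `|lo|)); first exact: measurable_funB.
    by move=> w; rewrite (le_trans (ler_normB _ _))// lerD2r.
  by rewrite RintegralB// Rintegral_probability_cst.
have q01 : 0 <= q <= 1.
  rewrite -pq Rintegral_ge0 => [|w _]; last by case/andP: (p01 w).
  rewrite -[leRHS](Rintegral_probability_cst 1) le_Rintegral// => w _.
  by case/andP: (p01 w).
apply: (@le_trans _ _ (\int[P]_w (a * (1 + b * p w)))).
  apply: le_Rintegral => //.
  - apply: (@bounded_integrable (expR (`|l| * K))).
      by apply: measurableT_comp => //; exact: measurable_funM.
    move=> w; rewrite ger0_norm ?expR_ge0// ler_expR.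
    by rewrite (le_trans (ler_norm _))// normrM ler_wpM2l.
  - apply: (@bounded_integrable (`|a| * (1 + `|b|))).
      by do 2![apply: measurable_funM => //; try apply: measurable_funD => //].
    move=> w; rewrite normrM ler_wpM2l// (le_trans (ler_normD _ _))// normr1 lerD2l.
    rewrite normrM ler_piMr//.
    by rewrite ger0_norm; case/andP: (p01 w).
have ibp : P.-integrable setT (EFin \o (fun w => b * p w)).
  apply: (@bounded_integrable `|b|); first exact: measurable_funM.
  move=> w; rewrite normrM ler_piMr//.
  by rewrite ger0_norm; case/andP: (p01 w).
rewrite RintegralZl//; last first.
  apply: (@bounded_integrable (1 + `|b|)).
    by apply: measurable_funD => //; apply: measurable_funM.
  move=> w; rewrite (le_trans (ler_normD _ _))// normr1 lerD2l normrM ler_piMr//.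
  by rewrite ger0_norm; case/andP: (p01 w).
rewrite RintegralD// RintegralZl// Rintegral_probability_cst pq.
have -> : l * \int[P]_w Y w + l ^+ 2 * c ^+ 2 / 8 =
    l * lo + (q * (l * c) + (l * c) ^+ 2 / 8).
  have -> : q * (l * c) = l * (\int[P]_w Y w - lo) * (c * c^-1) by rewrite /q; lra.
  by rewrite mulfV ?gt_eqF//; lra.
rewrite [leRHS]expRD ler_pM2l ?expR_gt0//.
apply: le_trans (hoeffding_scalar (l * c) q01).
by rewrite /b; lra.
Qed.

End bounded_integral.

(** * The bounded difference inequality *)

Section product_sigma_algebra.
Context n (d : 'I_n -> measure_display) (T : forall i, measurableType (d i)).
Local Notation X := (g_sigma_algebraType (cylinders T)).

Lemma measurable_coord i : measurable_fun setT ((fun z => z i) : X -> T i).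
Proof.
move=> _ A mA; rewrite setTI; apply: sub_sigma_algebra.
by exists i, A.
Qed.

Lemma measurable_to_product d' (Y : measurableType d') (g : Y -> X) :
  (forall i, measurable_fun setT (fun y => g y i)) -> measurable_fun setT g.
Proof.
move=> mg; apply: (@measurability _ _ Y X setT g (cylinders T)) => //.
move=> _ [_ [i [A [mA ->]]] <-].
exact: mg.
Qed.

Lemma measurable_dfwith d' (Y : measurableType d') (g : Y -> X) i
    (h : Y -> T i) : measurable_fun setT g -> measurable_fun setT h ->
  measurable_fun setT ((fun y => dfwith (g y) i (h y)) : Y -> X).
Proof.
move=> mg mh; apply: measurable_to_product => j.
have [<-|ij] := eqVneq i j.
  by under eq_fun do rewrite dfwithin.
under eq_fun do rewrite dfwithout//.
have := measurableT_comp (@measurable_coord j) mg; exact.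
Qed.

Definition rectangle (A : forall i, set (T i)) : set X :=
  [set z | forall i, A i (z i)].

Definition rectangles : set (set X) :=
  [set C | exists2 A, (forall i, measurable (A i)) & C = rectangle A].

Lemma rectangleE A :
  rectangle A = \bigcap_(i in [set: 'I_n]) ((fun z => z i) @^-1` A i).
Proof.
by apply/seteqP; split => z /= h => [i _|i]; [exact: h | exact: (h i)].
Qed.

Lemma rectangles_setI_closed : setI_closed rectangles.
Proof.
move=> _ _ [A mA ->] [B mB ->].
exists (fun i => A i `&` B i); first by move=> i; exact: measurableI.
apply/seteqP; split => z /=.
  by move=> [zA zB] i; split; [exact: zA|exact: zB].
by move=> zAB; split => i; case: (zAB i).
Qed.

Lemma measurable_rectangles : (measurable : set (set X)) = <<s rectangles >>.
Proof.
apply/seteqP; split; last first.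
  apply: smallest_sub; first exact: sigma_algebra_measurable.
  move=> _ [A mA ->]; rewrite rectangleE.
  apply: fin_bigcap_measurable => // i _.
  by rewrite -[X in measurable X]setTI; exact: measurable_coord.
apply: sub_sigma_algebra2 => _ [i [A [mA ->]]].
exists (dfwith (fun j => [set: T j]) i A).
  move=> j; have [<-|ij] := eqVneq i j; first by rewrite dfwithin.
  by rewrite dfwithout.
apply/seteqP; split => z /=.
  move=> zA j; have [<-|ij] := eqVneq i j; first by rewrite dfwithin.
  by rewrite dfwithout.
by move=> /(_ i); rewrite dfwithin.
Qed.

Lemma eq_measure_rectangles (R : realType) (m1 m2 : {measure set X -> \bar R}) :
  (m1 setT < +oo)%E ->
  (forall A, (forall i, measurable (A i)) -> m1 (rectangle A) = m2 (rectangle A)) ->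
  forall A, measurable A -> m1 A = m2 A.
Proof.
move=> m1oo m12; have setTE : [set: X] = rectangle (fun i => [set: T i]).
  by apply/seteqP; split.
apply: (measure_unique rectangles (fun=> setT)) => //.
- exact: measurable_rectangles.
- exact: rectangles_setI_closed.
- by move=> _; exists (fun i => [set: T i]).
- by apply/seteqP; split => // z _; exists 0%N.
- by move=> _ [A mA ->]; exact: m12.
Qed.

End product_sigma_algebra.

(** * Resampling of coordinates and the martingale argument *)

Section resampling.
Context {R : realType} dO (Omega : measurableType dO) (P : probability Omega R).
Context n (d : 'I_n -> measure_display) (T : forall i, measurableType (d i)).
Variable Z : forall i, {mfun Omega >-> T i}.
Hypothesis indZ : independent_components P (fun i => Z i : Omega -> T i).
Local Notation X := (g_sigma_algebraType (cylinders T)).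

Definition joint (w : Omega) : X := fun i => Z i w.

Lemma measurable_joint : measurable_fun setT joint.
Proof. by apply: measurable_to_product => i. Qed.

(* [resample i f] is the conditional expectation of [f] given the coordinates
   other than [i]. *)
Definition resample i (f : X -> R) : X -> R :=
  fun z => \int[P]_w f (dfwith z i (Z i w)).

Definition redraw i (ww : Omega * Omega) : X := dfwith (joint ww.1) i (Z i ww.2).

Lemma measurable_redraw i : measurable_fun setT (redraw i).
Proof.
apply: measurable_dfwith.
  exact: (measurableT_comp measurable_joint measurable_fst).
exact: measurableT_comp.
Qed.

HB.instance Definition _ :=
  isMeasurableFun.Build _ _ Omega X joint measurable_joint.
HB.instance Definition _ i :=
  isMeasurableFun.Build _ _ (Omega * Omega)%type X (redraw i) (measurable_redraw i).

(** On a rectangle, independence factors both probabilities into the same product of marginals; the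
    redrawn coordinate contributes its factor through the second copy of [Omega]. *)
Lemma distribution_redraw i A : measurable A ->
  distribution (P \x P)%E (redraw i) A = distribution P joint A.
Proof.
apply: eq_measure_rectangles.
  by rewrite (le_lt_trans (probability_le1 _ measurableT))// ltry.
move=> {}A mA; rewrite /distribution /pushforward /=.
have mZA j : measurable (Z j @^-1` A j).
  by rewrite -[X in measurable X]setTI; exact: measurable_funP.
have -> : redraw i @^-1` rectangle A =
    (\bigcap_(j in [set` [set~ i]%SET]) (Z j @^-1` A j)) `*` (Z i @^-1` A i).
  apply/seteqP; split => [[w w']|[w w']] /=.
    move=> h; split; last by have := h i; rewrite /redraw dfwithin.
    move=> j /=; rewrite in_setC1 => ji.
    by have := h j; rewrite /redraw dfwithout// eq_sym.
  move=> [hw hw'] j; have [<-|ij] := eqVneq i j; first by rewrite /redraw dfwithin.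
  by rewrite /redraw dfwithout//; apply: hw; rewrite /= in_setC1 eq_sym.
rewrite -[RHS]/(P (joint @^-1` rectangle A)).
have -> : joint @^-1` rectangle A =
    \bigcap_(j in [set` [set: 'I_n]%SET]) (Z j @^-1` A j).
  by apply/seteqP; split => w /= h j; [move=> _; exact: h|apply: h; rewrite /= inE].
rewrite product_measure1E//; last by apply: fin_bigcap_measurable.
rewrite indZ// (bigD1 i)/= ?finset.in_setT// muleC.
congr (_ * _)%E; apply: etrans (indZ _ mA) _.
by apply: eq_bigl => j; rewrite in_setC1 finset.in_setT.
Qed.

Section bounded_function.
Variables (K : R) (f : X -> R).
Hypotheses (mf : measurable_fun setT f) (fK : forall z, `|f z| <= K).

Let measurable_uncurried i :
  measurable_fun setT (fun zw : X * Omega => f (dfwith zw.1 i (Z i zw.2))).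
Proof.
apply: (measurableT_comp mf); apply: measurable_dfwith => //.
exact: (measurableT_comp _ measurable_snd).
Qed.

Lemma measurable_section_redraw i z :
  measurable_fun setT (fun w => f (dfwith z i (Z i w))).
Proof. by apply: (measurableT_comp mf); exact: measurable_dfwith. Qed.

Lemma resampleE i z :
  (\int[P]_w (f (dfwith z i (Z i w)))%:E)%E = (resample i f z)%:E.
Proof.
rewrite /resample /Rintegral fineK//; apply: integrable_fin_num => //.
apply: (@bounded_integrable _ _ _ P K _ (measurable_section_redraw i z)).
by move=> w; exact: fK.
Qed.

Lemma measurable_resample i : measurable_fun setT (resample i f).
Proof.
apply/measurable_EFinP.
have -> : EFin \o resample i f =
    fubini_F P (fun zw : X * Omega => (f (dfwith zw.1 i (Z i zw.2)))%:E).
  by apply/funext => z; rewrite /fubini_F resampleE.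
apply: (@measurable_fubini_F _ _ _ _ _ (distribution P joint) P).
apply: (@bounded_integrable _ _ _ (distribution P joint \x P)%E K) => [|zw].
  exact: measurable_uncurried.
exact: fK.
Qed.

Lemma resample_norm_le i z : `|resample i f z| <= K.
Proof. by apply: bounded_Rintegral_norm_le => //; exact: measurable_section_redraw. Qed.

(** The tower property: by Fubini the left-hand side is an integral over [P \x P], where the redrawn
    vector has the law of the original one. *)
Lemma resample_joint i :
  \int[P]_w resample i f (joint w) = \int[P]_w f (joint w).
Proof.
have mr := measurable_redraw i.
rewrite /Rintegral; congr fine.
have mfE : measurable_fun [set: X] (EFin \o f) by exact/measurable_EFinP.
have iPP : (P \x P)%E.-integrable setT (EFin \o (f \o redraw i)).
  have mfr : measurable_fun setT (f \o redraw i) := measurableT_comp mf mr.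
  exact (@bounded_integrable R _ _ (P \x P)%E K _ mfr (fun ww => fK _)).
have iP : P.-integrable setT (EFin \o (f \o joint)).
  have mfj : measurable_fun setT (f \o joint) := measurableT_comp mf measurable_joint.
  exact (@bounded_integrable R _ _ P K _ mfj (fun w => fK _)).
transitivity (\int[distribution P joint]_z (f z)%:E)%E; last first.
  exact: (integral_distribution mfE iP).
transitivity (\int[distribution (P \x P)%E (redraw i)]_z (f z)%:E)%E; last first.
  by apply: eq_measure_integral => A mA _; exact: distribution_redraw.
rewrite (integral_distribution mfE iPP) -integral12_prod_meas1//.
by apply: eq_integral => w _; rewrite /fubini_F -resampleE.
Qed.

End bounded_function.

Definition osc_le (f : X -> R) i (c : R) :=
  forall z zi, `|f (dfwith z i zi) - f z| <= c.

Lemma dfwith_dfwith (z : X) i (a b : T i) : dfwith (dfwith z i a) i b = dfwith z i b.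
Proof.
apply: functional_extensionality_dep => j.
by have [<-|ij] := eqVneq i j; rewrite ?dfwithin// !dfwithout.
Qed.

Lemma dfwithC (z : X) i j (a : T i) (b : T j) : i != j ->
  dfwith (dfwith z i a) j b = dfwith (dfwith z j b) i a.
Proof.
move=> ij; apply: functional_extensionality_dep => k.
have [<-|ik] := eqVneq i k; first by rewrite dfwithout 1?eq_sym// !dfwithin.
rewrite [RHS]dfwithout//.
by have [<-|jk] := eqVneq j k; rewrite ?dfwithin// !dfwithout.
Qed.

Lemma osc_le_section (f : X -> R) i c z : osc_le f i c ->
  forall w w', `|f (dfwith z i (Z i w)) - f (dfwith z i (Z i w'))| <= c.
Proof.
by move=> fc w w'; rewrite -(dfwith_dfwith z (Z i w') (Z i w)); exact: fc.
Qed.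

Lemma osc_le_resample (K : R) (f : X -> R) i j (c : R) : measurable_fun setT f ->
  (forall z, `|f z| <= K) -> 0 <= c -> osc_le f j c -> osc_le (resample i f) j c.
Proof.
move=> mf fK c0 fc z zj.
have [ij|ij] := eqVneq i j.
  move: fc zj; rewrite -{}ij => _ zi; rewrite /resample.
  by under eq_Rintegral do rewrite dfwith_dfwith; rewrite subrr normr0.
have iR y : P.-integrable setT (EFin \o (fun w => f (dfwith y i (Z i w)))).
  by apply: (@bounded_integrable _ _ _ P K) => //; exact: measurable_section_redraw.
rewrite /resample -RintegralB//; apply: bounded_Rintegral_norm_le.
  by apply: measurable_funB; exact: measurable_section_redraw.
by move=> w; rewrite dfwithC 1?eq_sym.
Qed.

Lemma osc_resample_eq0 f i : osc_le (resample i f) i 0.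
Proof.
move=> z zi; rewrite /resample.
by under eq_Rintegral do rewrite dfwith_dfwith; rewrite subrr normr0.
Qed.

Lemma osc_eq0_cst (f : X -> R) : (forall i, osc_le f i 0) -> forall z z', f z = f z'.
Proof.
move=> f0 z z'.
(* [z] is turned into [z'] one coordinate at a time. *)
pose g (s : seq 'I_n) : X := foldr (fun i y => dfwith y i (z' i)) z s.
have gE s : f (g s) = f z.
  elim: s => //= i s <-; have := f0 i (g s) (z' i).
  by rewrite normr_le0 subr_eq0 => /eqP.
rewrite -(gE (enum 'I_n)); congr f; apply: functional_extensionality_dep => j.
have : j \in enum 'I_n by rewrite mem_enum.
rewrite /g; elim: (enum _) => //= i s ih.
rewrite inE; have [<- _|ij] := eqVneq i j; first by rewrite dfwithin.
by move=> /= /ih <-; rewrite dfwithout.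
Qed.

(** By independence, averaging over the coordinates in [s] is conditioning on the others: this is
    the Doob martingale, read from [f] towards its mean. *)
Fixpoint resample_seq (s : seq 'I_n) (f : X -> R) : X -> R :=
  if s is i :: s' then resample i (resample_seq s' f) else f.

Section martingale.
Variables (K : R) (f : X -> R) (c : 'I_n -> R).
Hypotheses (mf : measurable_fun setT f) (fK : forall z, `|f z| <= K).
Hypotheses (c0 : forall i, 0 <= c i) (fc : forall i, osc_le f i (c i)).

Lemma resample_seq_measurable_bounded s :
  measurable_fun setT (resample_seq s f) /\ forall z, `|resample_seq s f z| <= K.
Proof.
elim: s => //= i s [ms sK]; split; first exact: (measurable_resample ms sK).
exact: (resample_norm_le ms sK).
Qed.

Lemma osc_resample_seq s i : osc_le (resample_seq s f) i (c i).
Proof.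
elim: s => //= j s ih; have [ms sK] := resample_seq_measurable_bounded s.
exact (osc_le_resample j ms sK (c0 i) ih).
Qed.

Lemma osc_resample_seq_eq0 s i : i \in s -> osc_le (resample_seq s f) i 0.
Proof.
elim: s => //= j s ih; rewrite inE => /predU1P[->|/ih i0].
  exact: osc_resample_eq0.
have [ms sK] := resample_seq_measurable_bounded s.
exact (osc_le_resample j ms sK (lexx 0) i0).
Qed.

Lemma Rintegral_resample_seq s :
  \int[P]_w resample_seq s f (joint w) = \int[P]_w f (joint w).
Proof.
elim: s => //= i s <-; have [ms sK] := resample_seq_measurable_bounded s.
exact: (resample_joint ms sK).
Qed.

Lemma expR_bounded (l : R) (g : X -> R) : (forall z, `|g z| <= K) ->
  forall z, `|expR (l * g z)| <= expR (`|l| * K).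
Proof.
move=> gK z; rewrite ger0_norm ?expR_ge0// ler_expR.
by rewrite (le_trans (ler_norm _))// normrM ler_wpM2l.
Qed.

(** Each resampling costs one application of Hoeffding's lemma in the averaged coordinate, where the
    oscillation is still at most [c i]. *)
Lemma mgf_resample_seq (l : R) s :
  \int[P]_w expR (l * f (joint w)) <=
  expR (l ^+ 2 / 8 * \sum_(i <- s) c i ^+ 2) *
    \int[P]_w expR (l * resample_seq s f (joint w)).
Proof.
elim: s => [|i s ih]; first by rewrite big_nil mulr0 expR0 mul1r.
apply: (le_trans ih); rewrite big_cons mulrDr addrC expRD -[leRHS]mulrA.
apply: ler_wpM2l; first exact: expR_ge0.
have [ms sK] := resample_seq_measurable_bounded s.
have [ms' sK'] := resample_seq_measurable_bounded (i :: s).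
set g := resample_seq s f in ms sK *.
have mexp (h : X -> R) : measurable_fun setT h ->
    measurable_fun setT (fun z => expR (l * h z)).
  by move=> mh; apply: measurableT_comp => //; exact: measurable_funM.
have mcj (h : X -> R) : measurable_fun setT h -> measurable_fun setT (h \o joint).
  by move=> mh; apply: measurableT_comp => //; exact: measurable_joint.
(* Integrating first over coordinate [i] alone allows Hoeffding's lemma to be applied pointwise in
   the other coordinates. *)
rewrite -(resample_joint (mexp _ ms) (expR_bounded l sK) i).
rewrite -RintegralZl//; last first.
  apply: (@bounded_integrable _ _ _ P (expR (`|l| * K))).
    exact: (mcj _ (mexp _ ms')).
  by move=> w; exact: (expR_bounded l sK').
apply: le_Rintegral => //.
- apply: (@bounded_integrable _ _ _ P (expR (`|l| * K))).
    apply: (mcj _ (measurable_resample (mexp _ ms) (expR_bounded l sK) i)).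
  by move=> w; exact: (resample_norm_le (mexp _ ms) (expR_bounded l sK)).
- apply: (@bounded_integrable _ _ _ P
    (expR (l ^+ 2 / 8 * c i ^+ 2) * expR (`|l| * K))).
    apply: measurable_funM => //; exact: (mcj _ (mexp _ ms')).
  move=> w; rewrite normrM ger0_norm ?expR_ge0// ler_wpM2l ?expR_ge0//.
  exact: (expR_bounded l sK').
move=> w _; rewrite /resample -expRD addrC mulrAC.
apply: hoeffding_mgf; first exact: (measurable_section_redraw ms).
exact/osc_le_section/osc_resample_seq.
Qed.

(** Once all coordinates are averaged the function is constant, equal to its mean, and its moment
    generating function is explicit. *)
Theorem mcdiarmid_mgf (l : R) :
  \int[P]_w expR (l * f (joint w)) <=
  expR (l * \int[P]_w f (joint w) + l ^+ 2 / 8 * \sum_i c i ^+ 2).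
Proof.
apply: (le_trans (mgf_resample_seq l (enum 'I_n))).
rewrite big_enum/= addrC expRD ler_wpM2l ?expR_ge0//.
rewrite -(Rintegral_resample_seq (enum 'I_n)).
have cst z : resample_seq (enum 'I_n) f z = resample_seq (enum 'I_n) f point.
  by apply: osc_eq0_cst => i; apply: osc_resample_seq_eq0; rewrite mem_enum.
under eq_Rintegral do rewrite cst.
under [in leRHS]eq_Rintegral do rewrite cst.
by rewrite !Rintegral_probability_cst.
Qed.

Theorem mcdiarmid (s : R) : 0 < \sum_i c i ^+ 2 -> 0 < s ->
  (P [set w | (f (joint w) >= \int[P]_w' f (joint w') + s)%R]
   <= (expR (- 2 * s ^+ 2 / \sum_i c i ^+ 2))%:E)%E.
Proof.
set V := \sum_i _ => V0 s0; set mu := \int[P]_w' _.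
(* This [l] minimises [- l * s + l ^+ 2 * V / 8], the exponent in Chernoff's bound. *)
pose l := 4 * s / V.
have l0 : 0 < l by rewrite divr_gt0// mulr_gt0.
have mfj : measurable_fun setT (f \o joint).
  by apply: (measurableT_comp mf); exact: measurable_joint.
pose Y : {mfun Omega >-> R} := HB.pack (f \o joint) (isMeasurableFun.Build _ _ _ _ _ mfj).
apply: le_trans; first exact (@chernoff _ _ _ P Y l (mu + s) l0).
have -> : 'M_ P Y l = (\int[P]_w expR (l * f (joint w)))%:E.
  rewrite /Rintegral fineK; last first.
    apply: integrable_fin_num => //.
    apply: (@bounded_integrable _ _ _ P (expR (`|l| * K))).
      by apply: measurableT_comp => //; exact: measurable_funM.
    by move=> w; exact: (expR_bounded l fK).
  rewrite /mmt_gen_fun unlock; apply: eq_integral => w _ /=.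
  by rewrite mulrC.
rewrite -EFinM lee_fin.
apply: (le_trans (ler_wpM2r (expR_ge0 _) (mcdiarmid_mgf l))).
rewrite -/mu -/V -expRD ler_expR.
have VV : V * V^-1 = 1 by rewrite mulfV// gt_eqF.
rewrite /l le_eqVlt; apply/orP; left; apply/eqP.
set v := V^-1 in VV *.
have -> : (4 * s * v) ^+ 2 / 8 * V = 2 * s ^+ 2 * v * (V * v) by lra.
by rewrite VV; lra.
Qed.

End martingale.

End resampling.

(** * Uniform deviation of randomised monotone functions *)

Section cofinal.
Context {R : realType}.
Implicit Types A : set R.

(** If [A] has no maximum, a rational separates each of its points from a larger one. Choosing for
    every rational a point of [A] above it, whenever there is one, gives the sequence. *)
Lemma cofinal_seq A : exists u : nat -> R,
  forall t, A t -> exists k, A (u k) /\ t <= u k.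
Proof.
have [[M AM maxM]|nomax] := pselect (exists2 M, A M & forall t, A t -> t <= M).
  by exists (fun=> M) => t /maxM tM; exists 0%N.
have up k : exists a : R, forall q : rat, unpickle k = Some q ->
    (exists2 a', A a' & ratr q <= a') -> A a /\ ratr q <= a.
  case: (unpickle k) => [q|]; last by exists 0.
  have [[a Aa qa]|na] := pselect (exists2 a' : R, A a' & ratr q <= a').
    by exists a => _ [<-].
  by exists 0 => _ [<-] /na.
have [u uP] := choice up.
exists u => t At.
have [t' At' tt'] : exists2 t', A t' & t < t'.
  apply: contrapT => h; apply: nomax; exists t => // t' At'.
  by rewrite leNgt; apply/negP => tt'; apply: h; exists t'.
have [q] := rat_in_itvoo tt'; rewrite in_itv/= => /andP[tq qt'].
exists (pickle q); have [|Au qu] := uP (pickle q) q (pickleK q).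
  by exists t' => //; exact: ltW.
by split => //; rewrite ltW// (lt_le_trans tq).
Qed.

Lemma coinitial_seq A : exists u : nat -> R,
  forall t, A t -> exists k, A (u k) /\ u k <= t.
Proof.
have [u uP] := cofinal_seq [set t | A (- t)].
exists (fun k => - u k) => t At; have [|k [Auk tuk]] := uP (- t).
  by rewrite /= opprK.
by exists k; split => //; rewrite lerNl.
Qed.

End cofinal.

(** * Unions of chains of events *)

Section chain.
Context {R : realType} d (Omega : measurableType d) (P : probability Omega R).

(** Finite unions in a chain are members of the chain, so continuity from below transfers the
    bound. *)
Lemma chain_bigcup_le (E : nat -> set Omega) (b : \bar R) :
  (forall k, measurable (E k)) -> (forall i j, E i `<=` E j \/ E j `<=` E i) ->
  (forall k, (P (E k) <= b)%E) -> (P (\bigcup_k E k) <= b)%E.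
Proof.
move=> mE chainE Eb.
pose G k := \big[setU/set0]_(i < k.+1) E i.
have mG k : measurable (G k) by apply: bigsetU_measurable => i _.
have GE k : exists i, G k = E i.
  elim: k => [|k [i GkE]]; first by exists 0%N; rewrite /G big_ord_recl big_ord0 setU0.
  have -> : G k.+1 = G k `|` E k.+1 by rewrite /G big_ord_recr.
  rewrite GkE; case: (chainE i k.+1) => h.
    by exists k.+1; exact/setUidPr.
  by exists i; exact/setUidPl.
have UG : \bigcup_k E k = \bigcup_k G k.
  apply/seteqP; split => [w [k _ Ekw]|w [k _]].
    by exists k => //; rewrite /G big_ord_recr /=; right.
  rewrite /G; elim: (k.+1) => [|m ih]; first by rewrite big_ord0.
  by rewrite big_ord_recr /= => -[/ih//|Emw]; exists m.
have cvg : P (G k) @[k --> \oo] --> P (\bigcup_k G k).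
  apply: nondecreasing_cvg_mu => //; first by apply: bigcup_measurable.
  by move=> m k mk; apply/subsetPset; exact: subset_bigsetU.
rewrite UG -(cvg_lim _ cvg)//.
apply: lime_le; first by apply/cvg_ex; exists (P (\bigcup_k G k)).
by apply: nearW => k; have [i ->] := GE k.
Qed.

(* The union of a chain of events has the supremum of their probabilities, so
   that [A] needs no greatest element. *)
Lemma monotone_process_cover (F : R -> Omega -> R) (A : set R) (a : R)
    (b : \bar R) :
  (forall t, measurable_fun setT (F t)) ->
  (forall s t w, s <= t -> F s w <= F t w) -> (0 <= b)%E ->
  (forall t, A t -> (P [set w | (a <= F t w)%R] <= b)%E) ->
  exists E, [/\ measurable E, (P E <= b)%E &
    forall t w, A t -> a <= F t w -> E w].
Proof.
move=> mF hF b0 Fb.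
have mFa t : measurable [set w | a <= F t w].
  exact: measurable_set_ge.
have [u uP] := cofinal_seq A.
pose E k := [set w | A (u k) /\ a <= F (u k) w].
have Ecase k : (A (u k) /\ E k = [set w | a <= F (u k) w]) \/ (~ A (u k) /\ E k = set0).
  have [Au|nAu] := pselect (A (u k)); [left|right]; split => //.
    by apply/seteqP; split => [w []//|w aF]; split.
  by apply/seteqP; split => // w [].
exists (\bigcup_k E k); split.
- by apply: bigcup_measurable => k _; case: (Ecase k) => -[_ ->].
- apply: chain_bigcup_le => [k|i j|k].
  + by case: (Ecase k) => -[_ ->].
  + case: (Ecase i) => -[Ai ->]; last by left.
    case: (Ecase j) => -[Aj ->]; last by right.
    have [ij|/ltW ji] := leP (u i) (u j); [left|right] => w /= aF;
      exact: (le_trans aF (hF _ _ _ _)).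
  + by case: (Ecase k) => -[Ak ->]; [exact: Fb|rewrite measure0].
- move=> t w /uP[k [Auk tuk]] aF; exists k => //; split => //.
  exact: (le_trans aF (hF _ _ _ _)).
Qed.

End chain.

(** * Bounded differences of a randomisation *)

Section oscillation.
Context {R : realType} {Theta : Type} (r : randomisation R Theta).

Lemma coord_osc_ge i theta (z : forall j, coord r j) (zi : coord r i) :
  `|rfun r (dfwith z i zi) theta - rfun r z theta| <= coord_osc r i.
Proof.
have [K rK] := rfun_bounded r.
apply: sup_upper_bound; last by exists theta, zi, z.
split; first by exists `|rfun r (dfwith z i zi) theta - rfun r z theta|, theta, zi, z.
exists (K + K) => _ [t [y [x ->]]].
by rewrite (le_trans (ler_normB _ _))// lerD.
Qed.

Lemma coord_osc_ge0 i : 0 <= coord_osc r i.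
Proof.
have [theta _] := index_nonempty r.
apply: le_trans (coord_osc_ge theta point (point : coord r i)).
exact: normr_ge0.
Qed.

Definition total_osc : R := \sum_(i < dimn r) coord_osc r i ^+ 2.

Definition mean_fun theta : R := \int[prob r]_w random_fun r theta w.

Lemma mean_funE theta : fine 'E_(prob r)[random_fun r theta] = mean_fun theta.
Proof. by rewrite unlock. Qed.

Lemma measurable_random_fun theta : measurable_fun setT (random_fun r theta).
Proof.
exact: (measurableT_comp (@rfun_measurable _ _ r theta) (measurable_joint (rvec r))).
Qed.

Lemma mcdiarmid_upper theta s : 0 < total_osc -> 0 < s ->
  (prob r [set w | (mean_fun theta + s <= random_fun r theta w)%R]
   <= (expR (- 2 * s ^+ 2 / total_osc))%:E)%E.
Proof.
move=> V0 s0; have [K rK] := rfun_bounded r.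
exact: (@mcdiarmid _ _ _ _ _ _ _ (rvec r) (@rvec_indep _ _ r) K
  (fun z => rfun r z theta) (coord_osc r) (@rfun_measurable _ _ r theta)
  (fun z => rK z theta) coord_osc_ge0 (fun i => coord_osc_ge theta) s V0 s0).
Qed.

Lemma mcdiarmid_lower theta s : 0 < total_osc -> 0 < s ->
  (prob r [set w | (random_fun r theta w <= mean_fun theta - s)%R]
   <= (expR (- 2 * s ^+ 2 / total_osc))%:E)%E.
Proof.
move=> V0 s0; have [K rK] := rfun_bounded r.
have mf := @rfun_measurable _ _ r theta.
have mfN : measurable_fun setT
  ((fun z => - rfun r z theta) : g_sigma_algebraType (cylinders (coord r)) -> R).
  exact: measurable_funN.
have fK z : `|- rfun r z theta| <= K by rewrite normrN.
have oscN i : osc_le (fun z => - rfun r z theta) i (coord_osc r i).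
  by move=> z zi; rewrite -opprD normrN; exact: coord_osc_ge.
have := @mcdiarmid _ _ _ _ _ _ _ (rvec r) (@rvec_indep _ _ r) K
  _ _ mfN fK coord_osc_ge0 oscN s V0 s0.
apply: le_trans; rewrite le_eqVlt; apply/orP; left; apply/eqP.
congr (prob r _); apply/seteqP.
have -> : \int[prob r]_w' - rfun r (joint (rvec r) w') theta = - mean_fun theta.
  rewrite -mulN1r -RintegralZl//; last first.
    apply: (@bounded_integrable _ _ _ (prob r) K); first exact: measurable_random_fun.
    by move=> w; exact: rK.
  by apply: eq_Rintegral => w _; rewrite mulN1r.
by split => w /=; rewrite -/(random_fun r theta w); lra.
Qed.

End oscillation.

(** * Tails of the uniform deviation *)

Section monotone_tail.
Context {R : realType} (r : randomisation R R).
Hypothesis mono : randomised_monotone r.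
Local Notation F := (random_fun r).
Local Notation g := (mean_fun r).

Lemma random_fun_homo s t w : s <= t -> F s w <= F t w.
Proof. by move=> st; have [h _] := mono (fun i => rvec r i w); exact: h. Qed.

Lemma random_fun01 t w : 0 <= F t w <= 1.
Proof. by have [_ h] := mono (fun i => rvec r i w); exact: h. Qed.

Lemma random_fun_integrable t : (prob r).-integrable setT (EFin \o F t).
Proof.
apply: (@bounded_integrable _ _ _ (prob r) 1); first exact: measurable_random_fun.
by move=> w; have /andP[F0 F1] := random_fun01 t w; rewrite ger0_norm.
Qed.

Lemma mean_fun01 t : 0 <= g t <= 1.
Proof.
apply/andP; split; first by apply: Rintegral_ge0 => w _; case/andP: (random_fun01 t w).
rewrite -[leRHS](Rintegral_probability_cst (prob r) 1).
apply: le_Rintegral => //; first exact: random_fun_integrable.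
- by apply: (@bounded_integrable _ _ _ (prob r) 1) => // w; rewrite normr1.
- by move=> w _; case/andP: (random_fun01 t w).
Qed.

Definition deviation t w : R := F t w - g t.

Lemma deviation_le1 t w : `|deviation t w| <= 1.
Proof.
have := random_fun01 t w; have := mean_fun01 t.
by rewrite /deviation ler_norml; lra.
Qed.

Lemma measurable_deviation t : measurable_fun setT (deviation t).
Proof. by apply: measurable_funB => //; exact: measurable_random_fun. Qed.

Lemma sup_deviationE w : sup_deviation r w = sup [set `|deviation t w| | t in [set: R]].
Proof.
by congr sup; apply/seteqP; split => _ [t _ <-]; exists t => //;
  rewrite /deviation mean_funE.
Qed.

Lemma has_sup_deviation w : has_sup [set `|deviation t w| | t in [set: R]].
Proof.
split; first by exists `|deviation 0 w|, 0.
by exists 1 => _ [t _ <-]; exact: deviation_le1.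
Qed.

Lemma deviation_le_sup t w : `|deviation t w| <= sup_deviation r w.
Proof.
rewrite sup_deviationE; apply: sup_upper_bound; first exact: has_sup_deviation.
by exists t.
Qed.

Lemma sup_deviation_le1 w : sup_deviation r w <= 1.
Proof.
rewrite sup_deviationE; apply: sup_le_ub; first by exists `|deviation 0 w|, 0.
by move=> _ [t _ <-]; exact: deviation_le1.
Qed.

Lemma sup_deviation_gt s w : s < sup_deviation r w -> exists t, s < `|deviation t w|.
Proof.
rewrite sup_deviationE => /(sup_gt (has_sup_deviation w).1)[_ [t _ <-] ?].
by exists t.
Qed.

Definition level (delta : R) (j : nat) : set R :=
  [set t | j%:R * delta <= g t < j.+1%:R * delta].

Lemma levelP (delta : R) t : 0 < delta -> exists j, level delta j t.
Proof.
move=> d0; have /andP[g0 _] := mean_fun01 t.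
exists (Num.truncn (g t / delta)); rewrite /level /=.
have : 0 <= g t / delta by rewrite divr_ge0// ltW.
move=> /truncn_itv/andP[].
by rewrite ler_pdivlMr// ltr_pdivrMr// => -> ->.
Qed.

Lemma level_lt (delta : R) t j K : 0 < delta -> 1 < K%:R * delta ->
  level delta j t -> (j < K)%N.
Proof.
move=> d0 K1 /andP[jd _]; have /andP[_ g1] := mean_fun01 t.
by rewrite -(ltr_nat R) -(ltr_pM2r d0) (le_lt_trans jd)// (le_lt_trans g1).
Qed.

(* Over a level the deviation is monotone in [t] up to [delta], hence it is
   enough to look along a countable cofinal or coinitial sequence. *)
Lemma level_deviation (delta : R) j s t w : level delta j s -> level delta j t ->
  s <= t -> deviation s w <= deviation t w + delta.
Proof.
move=> /andP[ls _] /andP[_ lt] st; have := random_fun_homo w st.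
by move: lt; rewrite -natr1 /deviation; lra.
Qed.

(** The uncountable supremum is reduced to countable operations: a point of nearly maximal deviation
    can be moved along the chosen sequences of its level at a controlled loss. *)
Lemma measurable_sup_deviation_ge s : measurable [set w | s <= sup_deviation r w].
Proof.
pose A (mj : nat * nat) := level (mj.1.+1%:R * 2)^-1 mj.2.
have [u uP] := choice (fun mj => cofinal_seq (A mj)).
have [v vP] := choice (fun mj => coinitial_seq (A mj)).
pose D t m := [set w | s - m.+1%:R^-1 < `|deviation t w|].
have mD t m : measurable (D t m).
  by apply: measurable_set_gt; apply: measurableT_comp => //; exact: measurable_deviation.
have -> : [set w | s <= sup_deviation r w] = \bigcap_m \bigcup_j \bigcup_k
    (D (u (m, j) k) m `|` D (v (m, j) k) m).
  apply/seteqP; split => w /=.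
    move=> sw m _; have m0 : 0 < m.+1%:R * 2 :> R by rewrite mulr_gt0.
    have [t tw] : exists t, s - (m.+1%:R * 2)^-1 < `|deviation t w|.
      by apply: sup_deviation_gt; rewrite ltrBlDr (le_lt_trans sw)// ltrDl invr_gt0.
    have e0 : 0 < (m.+1%:R * 2)^-1 :> R by rewrite invr_gt0.
    have [j jt] := levelP t e0.
    (* The tolerance is halved: one half for the near-maximality of [t], the other for the width of
       the levels. *)
    have eE : m.+1%:R^-1 = (m.+1%:R * 2)^-1 + (m.+1%:R * 2)^-1 :> R.
      by rewrite invfM -mulrDr -[LHS]mulr1; congr (_ * _); lra.
    rewrite /A /= in uP vP; move: (uP (m, j) t jt) (vP (m, j) t jt).
    rewrite /D /= eE; set e := (_ * 2)^-1 in tw jt * => -[k [lu tu]] [k' [lv vt]].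
    exists j => //; move: tw; rewrite ltr_normr => /orP[tw|tw].
      exists k => //; left; rewrite /= ltr_normr; apply/orP; left.
      by have := level_deviation w jt lu tu; lra.
    exists k' => //; right; rewrite /= ltr_normr; apply/orP; right.
    by have := level_deviation w lv jt vt; lra.
  move=> h; apply/ler_addgt0Pr => e e0.
  have me : (Num.truncn e^-1).+1%:R^-1 < e.
    by rewrite invf_plt ?posrE//; exact: truncnS_gt.
  have [j _ [k _ [|]]] := h (Num.truncn e^-1) I; rewrite /D /=;
    set v0 := (_.+1%:R)^-1 in me *.
    by have := deviation_le_sup (u (Num.truncn e^-1, j) k) w; lra.
  by have := deviation_le_sup (v (Num.truncn e^-1, j) k) w; lra.
apply: bigcap_measurableType => m _; apply: bigcup_measurable => j _.
by apply: bigcup_measurable => k _; exact: measurableU.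
Qed.

(** One [delta] is lost in passing from the supremum to some [t], another through the width of a
    level. Each of the [K] levels contributes one event for upper and one for lower deviations. *)
Lemma sup_deviation_tail (delta s : R) (K : nat) : 0 < total_osc r ->
  0 < delta -> 1 < K%:R * delta -> 2 * delta < s ->
  (prob r [set w | (s <= sup_deviation r w)%R] <=
   (2 * K%:R * expR (- 2 * (s - 2 * delta) ^+ 2 / total_osc r))%:E)%E.
Proof.
move=> V0 d0 K1 ds; set b := expR _.
have s'0 : 0 < s - 2 * delta by lra.
have upper j : exists E, [/\ measurable E, (prob r E <= b%:E)%E &
    forall t w, level delta j t -> s - delta < deviation t w -> E w].
  have [|||t lt|E [mE Eb hE]] := @monotone_process_cover _ _ _ (prob r) F
      (level delta j) (j%:R * delta + (s - delta)) b%:E.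
  - exact: measurable_random_fun.
  - exact: random_fun_homo.
  - by rewrite lee_fin expR_ge0.
  - apply: le_trans (mcdiarmid_upper t V0 s'0).
    apply: le_measure; rewrite ?inE.
    + by apply: measurable_set_ge; exact: measurable_random_fun.
    + by apply: measurable_set_ge; exact: measurable_random_fun.
    + move: lt => /andP[_]; rewrite -natr1 => lt w /=; lra.
  - exists E; split => // t w lt dw; apply: (hE t w lt).
    by move: lt => /andP[lt _]; move: dw; rewrite /deviation; lra.
have lower j : exists E, [/\ measurable E, (prob r E <= b%:E)%E &
    forall t w, level delta j t -> deviation t w < - (s - delta) -> E w].
  (* Reflecting both [t] and the sign turns lower deviations into a process nondecreasing in [t]. *)
  have [|||t lt|E [mE Eb hE]] := @monotone_process_cover _ _ _ (prob r)
      (fun t w => - F (- t) w) [set t | level delta j (- t)]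
      (s - delta - j.+1%:R * delta) b%:E.
  - by move=> t; apply: measurable_funN; exact: measurable_random_fun.
  - by move=> t t' w tt'; rewrite lerN2; apply: random_fun_homo; rewrite lerN2.
  - by rewrite lee_fin expR_ge0.
  - apply: le_trans (mcdiarmid_lower (- t) V0 s'0).
    apply: le_measure; rewrite ?inE.
    + by apply: measurable_set_ge; apply: measurable_funN; exact: measurable_random_fun.
    + by apply: measurable_set_le; exact: measurable_random_fun.
    + move: lt => /andP[lt _] w /=; rewrite -natr1; lra.
  - exists E; split => // t w lt dw; apply: (hE (- t) w); rewrite /= opprK//.
    by move: lt => /andP[_ lt]; move: dw; rewrite /deviation; lra.
have [E EP] := choice upper; have [E' EP'] := choice lower.
pose B := \big[setU/set0]_(j < K) (E j `|` E' j).
have mB : measurable B.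
  apply: bigsetU_measurable => j _; apply: measurableU.
    by have [] := EP j.
  by have [] := EP' j.
apply: (@le_trans _ _ (prob r B)).
  apply: le_measure; rewrite ?inE//; first exact: measurable_sup_deviation_ge.
  move=> w /= sw; have [t tw] : exists t, s - delta < `|deviation t w|.
    by apply: sup_deviation_gt; lra.
  have [j jt] := levelP t d0; have jK := level_lt d0 K1 jt.
  rewrite /B -(bigcup_mkord K (fun j => E j `|` E' j)); exists j => //.
  have [_ _ h] := EP j; have [_ _ h'] := EP' j.
  by move: tw; rewrite ltr_normr => /orP[tw|tw]; [left; exact: (h t)|right; apply: (h' t) => //; lra].
apply: (@le_trans _ _ (\sum_(j < K) prob r (E j `|` E' j))%E).
  rewrite /B; elim: (K) => [|k ih]; first by rewrite !big_ord0 measure0.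
  rewrite !big_ord_recr/=; apply: le_trans (leeD2r _ ih).
  have mEU j : measurable (E j `|` E' j).
    by apply: measurableU; [have [] := EP j|have [] := EP' j].
  by apply: measureU2 => //; exact: bigsetU_measurable.
apply: (@le_trans _ _ (\sum_(j < K) (2 * b)%:E)%E).
  apply: lee_sum => j _; have [mE Eb _] := EP j; have [mE' Eb' _] := EP' j.
  apply: le_trans (measureU2 _ mE mE') _.
  have -> : (2 * b)%:E = (b%:E + b%:E)%E by rewrite -EFinD; congr EFin; lra.
  exact: leeD.
by rewrite sumEFin lee_fin sumr_const card_ord -mulr_natr; lra.
Qed.

End monotone_tail.

(** * Upper bound *)

Section numerics.
Context {R : realType}.

Lemma ln2_gt0 : 0 < ln 2 :> R. Proof. by rewrite ln_gt0// ltr1n. Qed.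

(** [ln u <= (u - u^-1) / 2] is applied at [u = 2 ^ (1 / 4)], near enough to 1 for it to be sharp;
    [69 / 58] is just above [u]. *)
Lemma ln2_le : ln 2 <= 7 / 10 :> R.
Proof.
pose u : R := Num.sqrt (Num.sqrt 2).
have u4 : u ^+ 4 = 2 by rewrite (exprM u 2 2) !sqr_sqrtr// sqrtr_ge0.
have u0 : 0 <= u by exact: sqrtr_ge0.
have u1 : 1 <= u by rewrite -(ler_pXn2r (_ : (0 < 4)%N)) ?nnegrE// u4 expr1n; lra.
have ule : u <= 69 / 58.
  by rewrite -(ler_pXn2r (_ : (0 < 4)%N)) ?nnegrE ?u4//; lra.
have -> : ln 2 = 4 * ln u :> R.
  have lu : ln (u ^+ 4) = ln u *+ 4 by rewrite lnXn//; lra.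
  by rewrite -{1}u4 lu; lra.
have := ln_le_half_sub_inv u1.
have : (69 / 58)^-1 <= u^-1 by rewrite lef_pV2 ?posrE//; lra.
by lra.
Qed.

(* [1 / 2 <= expR (- 17 / 25)] by squaring [783 / 800 <= expR (- 17 / 800)] five
   times, rounding down after each step. *)
Lemma ln2_ge : 17 / 25 <= ln 2 :> R.
Proof.
rewrite -ler_expR lnK ?posrE//.
have sq (a b y : R) : 0 <= b -> b <= expR (- y) -> a <= b ^+ 2 -> a <= expR (- (2 * y)).
  move=> b0 ba ab; apply: (le_trans ab).
  have -> : - (2 * y) = 2%:R * - y by lra.
  by rewrite expRM_natl ler_pXn2r ?nnegrE ?expR_ge0.
have h0 : 783 / 800 <= expR (- (17 / 800)) :> R.
  by have := expR_ge1Dx (- (17 / 800) : R); lra.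
have h1 : 91 / 95 <= expR (- (2 * (17 / 800))) :> R by apply: (sq _ _ _ _ h0); lra.
have h2 := sq (100 / 109) _ _ _ h1.
have {}h2 : 100 / 109 <= expR (- (2 * (2 * (17 / 800)))) :> R by apply: h2; lra.
have h3 := sq (101 / 120) _ _ _ h2.
have {}h3 : 101 / 120 <= expR (- (2 * (2 * (2 * (17 / 800))))) :> R by apply: h3; lra.
have h4 := sq (17 / 24) _ _ _ h3.
have {}h4 : 17 / 24 <= expR (- (2 * (2 * (2 * (2 * (17 / 800)))))) :> R by apply: h4; lra.
have h5 := sq (1 / 2) _ _ _ h4.
have {}h5 : 1 / 2 <= expR (- (17 / 25)) :> R.
  have -> : 17 / 25 = 2 * (2 * (2 * (2 * (2 * (17 / 800))))) :> R by lra.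
  by apply: h5; lra.
have ee : expR (17 / 25) * expR (- (17 / 25)) = 1 :> R by rewrite -expRD subrr expR0.
have := ler_wpM2l (expR_ge0 (17 / 25 : R)) h5.
by rewrite ee; lra.
Qed.

Lemma ln4E : ln 4 = 2 * ln 2 :> R.
Proof.
have -> : 4 = 2 ^+ 2 :> R by rewrite expr2; lra.
by rewrite lnXn// mulr_natl.
Qed.

Lemma ln8E : ln 8 = 3 * ln 2 :> R.
Proof.
have -> : 8 = 2 ^+ 3 :> R by rewrite -natrX.
by rewrite lnXn// mulr_natl.
Qed.

Lemma ln_ge_sub_inv (u : R) : 0 < u -> 1 - u^-1 <= ln u.
Proof.
move=> u0; have := @le_ln1Dx R (u^-1 - 1).
have iu : 0 < u^-1 by rewrite invr_gt0.
by rewrite addrCA subrr addr0 lnV ?posrE// => /(_ ltac:(lra)); lra.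
Qed.

(** Constant lower bounds on four subintervals suffice. The slope is one eighth of [17 / 10], the
    loss in the second alternative of [sqrt_opt_ge_small]. *)
Lemma linear_le_ln (s : R) : 4 <= s -> s <= 19 / 2 -> 17 / 80 * s <= ln s.
Proof.
move=> s4 s95; have l2 := ln2_ge; have l4 := ln4E; have l8 := ln8E.
have lnge (u : R) : 0 < u -> u <= s -> ln u <= ln s.
  by move=> u0 us; rewrite ler_ln ?posrE//; exact: lt_le_trans us.
have [s6|s6] := leP s 6; first by have := lnge 4; lra.
have [s75|s75] := leP s (15 / 2).
  have := lnge 6; have -> : ln 6 = 2 * ln 2 + ln (3 / 2) :> R.
    by rewrite -l4 -lnM ?posrE//; congr ln; lra.
  by have := @ln_ge_sub_inv (3 / 2); lra.
have [s9|s9] := leP s 9.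
  have := lnge (15 / 2); have -> : ln (15 / 2) = 3 * ln 2 + ln (15 / 16) :> R.
    by rewrite -l8 -lnM ?posrE//; congr ln; lra.
  by have := @ln_ge_sub_inv (15 / 16); lra.
by have := lnge 8; lra.
Qed.

Lemma expR1_ge2 : 2 <= expR 1 :> R.
Proof. by have := expR_ge1Dx (1 : R); lra. Qed.

End numerics.

(** * Sufficient conditions for the tail bound *)

Section upper_bound.
Context {R : realType}.
Implicit Types (r : randomisation R R) (x y A B eps : R).

Lemma eff_sizeP r : (eff_size r < +oo)%E ->
  0 < total_osc r /\ fine (eff_size r) = (total_osc r)^-1.
Proof.
have V0 : 0 <= total_osc r by apply: sumr_ge0 => i _; exact: sqr_ge0.
rewrite /eff_size -/(total_osc r) inver.
have [->|V1] := eqVneq (total_osc r) 0; first by rewrite ltxx.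
by move=> _; split => //; rewrite lt_neqAle eq_sym V1.
Qed.

Definition tail_bound r y B := forall eps, 0 < eps ->
  (prob r [set w | (eps * Num.sqrt B <= Num.sqrt y * sup_deviation r w)%R]
   <= (2 * expR (- 2 * eps ^+ 2))%:E)%E.

Lemma measurable_tail r y a : randomised_monotone r -> 0 < y ->
  measurable [set w | a <= Num.sqrt y * sup_deviation r w].
Proof.
move=> mono y0; have sy : 0 < Num.sqrt y by rewrite sqrtr_gt0.
have -> : [set w | a <= Num.sqrt y * sup_deviation r w] =
    [set w | a / Num.sqrt y <= sup_deviation r w].
  by apply/seteqP; split => w /=; rewrite ler_pdivrMr// mulrC.
exact: measurable_sup_deviation_ge.
Qed.

(** For such [eps] the right-hand side is at least 1. *)
Lemma tail_bound_small_eps r y B eps : randomised_monotone r -> 0 < y ->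
  2 * eps ^+ 2 <= ln 2 ->
  (prob r [set w | (eps * Num.sqrt B <= Num.sqrt y * sup_deviation r w)%R]
   <= (2 * expR (- 2 * eps ^+ 2))%:E)%E.
Proof.
move=> mono y0 eps2.
apply: (le_trans (probability_le1 (prob r) (measurable_tail _ mono y0))).
rewrite lee_fin mulNr expRN -ler_pdivrMr ?invr_gt0 ?expR_gt0// invrK mul1r.
by rewrite -[leRHS]lnK ?posrE// ler_expR.
Qed.

Lemma tail_bound_trivial r y B : randomised_monotone r -> 0 < y ->
  2 * y / ln 2 <= B -> tail_bound r y B.
Proof.
move=> mono y0 yB eps eps0; have l0 := @ln2_gt0 R.
have [|eps2] := leP (2 * eps ^+ 2) (ln 2); first exact: tail_bound_small_eps.
rewrite (_ : [set w | _] = set0) ?measure0 ?lee_fin ?mulr_ge0 ?expR_ge0//.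
apply/seteqP; split => // w /= h.
have {}h : eps * Num.sqrt B <= Num.sqrt y.
  by rewrite (le_trans h)// ler_piMr ?sqrtr_ge0// sup_deviation_le1.
have B0 : 0 <= B by rewrite (le_trans _ yB)// divr_ge0 ?ltW// mulr_gt0.
have {}h : eps ^+ 2 * B <= y.
  rewrite -[B]sqr_sqrtr// -[y]sqr_sqrtr ?(ltW y0)// -exprMn.
  by rewrite ler_pXn2r ?nnegrE ?mulr_ge0 ?sqrtr_ge0 ?(ltW eps0).
move: yB; rewrite ler_pdivrMr// => yB.
have [B00|Bn0] := eqVneq B 0; first by move: yB; rewrite B00 mul0r; lra.
have Bp : 0 < B by rewrite lt_neqAle eq_sym Bn0.
have : ln 2 * B < 2 * eps ^+ 2 * B by rewrite ltr_pM2r.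
by lra.
Qed.

(* A candidate need only be optimised at [x]: elsewhere the adjustment
   [2 * y / ln 2], for which the event is empty whenever the bound is
   nontrivial, will do. *)
Lemma opt_adjustment_le x B : 0 < x -> 0 <= B ->
  (forall r, randomised_monotone r -> total_osc r = x^-1 -> tail_bound r x B) ->
  opt_adjustment x <= B /\ has_inf [set U x | U in @adjustment R].
Proof.
move=> x0 B0 tailB.
pose U y := if y == x then B else 2 * y / ln 2.
have l0 := @ln2_gt0 R.
have adjU : @adjustment R U.
  split => [y y0|r mono /eff_sizeP[V0 VE] eps eps0].
    by rewrite /U; case: ifP => // _; rewrite divr_ge0 ?mulr_ge0//; exact: ltW.
  rewrite VE /U; case: ifPn => [/eqP Vx|_].
    rewrite Vx; apply: tailB => //; by rewrite -Vx invrK.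
  by apply: tail_bound_trivial => //; rewrite invr_gt0.
have lb : lbound [set U x | U in @adjustment R] 0.
  by move=> _ [U' [U'0 _] <-]; apply: U'0; exact: ltW.
split; last by split; [exists (U x), U | exists 0].
by apply: ge_inf; [exists 0 | exists U => //; rewrite /U eqxx].
Qed.

(* The bound is trivial for [eps <= sqrt (ln 2 / 2)] and only improves as [eps]
   grows beyond; [71 / 30] bounds [4 * sqrt (ln 2 / 2)], the cross term of
   [(eps * A - A^-1) ^+ 2] at that threshold. *)
Lemma tail_bound_main r x A : randomised_monotone r -> total_osc r = x^-1 ->
  1 <= x -> 0 <= A ->
  ln (2 * A * Num.sqrt x + 1) + 71 / 30 <= ln 2 * (A ^+ 2 - 1) ->
  tail_bound r x (A ^+ 2).
Proof.
move=> mono Vx x1 A0 cond eps eps0.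
have x0 : 0 < x by lra.
have [|eps2] := leP (2 * eps ^+ 2) (ln 2); first exact: tail_bound_small_eps.
have l2 := @ln2_le R; have l2' := @ln2_ge R.
set q := Num.sqrt x in cond *.
have q2 : q ^+ 2 = x by rewrite sqr_sqrtr// ltW.
have q0 : 0 < q by rewrite sqrtr_gt0.
have lnK0 : 0 <= ln (2 * A * q + 1) by rewrite ln_ge0// lerDr !mulr_ge0// ltW.
pose a := A ^+ 2 - 1.
have a3 : 33 / 10 <= a.
  by rewrite /a in cond *; nra.
have A1 : 1 < A by rewrite /a in a3; nra.
rewrite sqrtr_sqr (ger0_norm A0).
pose e0 : R := Num.sqrt (ln 2 / 2).
have e02 : e0 ^+ 2 = ln 2 / 2 by rewrite sqr_sqrtr//; lra.
have e00 : 0 <= e0 by exact: sqrtr_ge0.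
have e0le : e0 <= 71 / 120 by nra.
have e0ge : 29 / 50 <= e0 by nra.
have epse0 : e0 < eps by nra.
(* Chosen so that [2 * delta * sqrt x = A^-1]: after scaling by [sqrt x] the discretisation lowers
   [eps * A] by [A^-1] only, at the price of about [2 * A * sqrt x] levels. *)
pose delta := (2 * A * q)^-1.
pose K := (Num.truncn (2 * A * q)).+1.
have Aq0 : 0 < 2 * A * q by rewrite !mulr_gt0//; lra.
have d0 : 0 < delta by rewrite invr_gt0.
have K1 : 1 < K%:R * delta by rewrite ltr_pdivlMr// mul1r truncnS_gt.
have Kle : K%:R <= 2 * A * q + 1.
  by rewrite /K -natr1 lerD2r truncn_le// ltW.
have dE : 2 * delta * q = A^-1.
  rewrite /delta !invfM; have qq : q^-1 * q = 1 by rewrite mulVf// gt_eqF.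
  have -> : 2 * (2^-1 * A^-1 * q^-1) * q = A^-1 * (q^-1 * q) by lra.
  by rewrite qq mulr1.
have AA : A * A^-1 = 1 by rewrite mulfV//; lra.
pose s := eps * A / q.
have qs : s * q = eps * A by rewrite /s divfK// gt_eqF.
have iA : 0 < A^-1 by rewrite invr_gt0; lra.
have ds : 2 * delta < s.
  rewrite -(ltr_pM2r q0) qs dE -(ltr_pM2r (_ : 0 < A)); last lra.
  by rewrite mulVf; [nra | lra].
have V0 : 0 < total_osc r by rewrite Vx invr_gt0.
have -> : [set w | (eps * A <= q * sup_deviation r w)%R] =
    [set w | (s <= sup_deviation r w)%R].
  by apply/seteqP; split => w /=; rewrite /s ler_pdivrMr// [q * _]mulrC.
apply: (le_trans (sup_deviation_tail mono V0 d0 K1 ds)).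
rewrite lee_fin -mulrA ler_pM2l//.
have -> : - 2 * (s - 2 * delta) ^+ 2 / total_osc r = - 2 * (eps * A - A^-1) ^+ 2.
  by rewrite Vx invrK -q2 -qs -dE; lra.
have KK : 0 < K%:R :> R by rewrite ltr0n.
rewrite -[K%:R]lnK ?posrE// -expRD ler_expR.
have lnKle : ln K%:R <= ln (2 * A * q + 1) by rewrite ler_ln ?posrE//; lra.
have -> : (eps * A - A^-1) ^+ 2 = eps ^+ 2 * A ^+ 2 - 2 * eps * (A * A^-1) + A^-1 ^+ 2.
  by lra.
rewrite AA.
have h1 : 0 <= A^-1 ^+ 2 by exact: sqr_ge0.
(* This says [4 * (eps - e0) <= 2 * a * (eps ^+ 2 - e0 ^+ 2)] and reduces the required inequality to
   [eps = e0]. *)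
have h2 : 0 <= (eps - e0) * (2 * a * (eps + e0) - 4).
  by apply: mulr_ge0; [lra | nra].
have h3 : 2 * e0 ^+ 2 * a = ln 2 * a by rewrite e02; lra.
have AE : A ^+ 2 = a + 1 by rewrite /a; lra.
rewrite AE; rewrite -/a in cond.
by lra.
Qed.

End upper_bound.

(** * Numerical estimates for the upper bound *)

Section upper_bound_numerics.
Context {R : realType}.
Variables (x : R) (x1 : 1 < x).
Local Notation L := (ln x).
Local Notation l := (@ln R 2).
Local Notation y := (Num.sqrt (log4 x)).

Lemma gt0_x : 0 < x. Proof. exact: lt_trans x1. Qed.

Lemma ln_gt0_x : 0 < L. Proof. exact: ln_gt0. Qed.

Lemma log4_sqr : 2 * l * y ^+ 2 = L.
Proof.
have l0 := @ln2_gt0 R; have L0 := ln_gt0_x.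
rewrite sqr_sqrtr /log4 ln4E; last by rewrite divr_ge0 ?mulr_ge0// ltW.
by rewrite mulrC divfK// gt_eqF// mulr_gt0.
Qed.

Lemma sqrt_log4_ge0 : 0 <= y. Proof. exact: sqrtr_ge0. Qed.

Lemma sqrt_log4_ge c : 0 <= c -> 2 * l * c ^+ 2 <= L -> c <= y.
Proof.
move=> c0; rewrite -log4_sqr ler_pM2l ?mulr_gt0// ?ln2_gt0//.
by rewrite ler_pXn2r// ?nnegrE// sqrt_log4_ge0.
Qed.

Lemma sqrt_opt_le A : 0 <= A -> (forall r : randomisation R R,
    randomised_monotone r -> total_osc r = x^-1 -> tail_bound r x (A ^+ 2)) ->
  Num.sqrt (opt_adjustment x) <= A.
Proof.
move=> A0 tA; have x0 := gt0_x.
have [oA _] := opt_adjustment_le x0 (sqr_ge0 A) tA.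
by rewrite -[leRHS](ger0_norm A0) -sqrtr_sqr ler_wsqrtr.
Qed.

Lemma sqrt_opt_le_trivial A : 0 <= A -> 2 * x <= l * A ^+ 2 ->
  Num.sqrt (opt_adjustment x) <= A.
Proof.
move=> A0 xA; apply: sqrt_opt_le => // r mono Vx.
apply: tail_bound_trivial => //; first exact: gt0_x.
by rewrite ler_pdivrMr ?ln2_gt0// [_ * l]mulrC.
Qed.

(** In [tail_bound_main] the factor [sqrt x] has logarithm [ln 2 * y ^+ 2]; splitting it off leaves
    a condition on the excess of [A ^+ 2] over [y ^+ 2]. *)
Lemma sqrt_opt_le_main A : 0 <= A ->
  ln (2 * A + (Num.sqrt x)^-1) + 71 / 30 <= l * (A ^+ 2 - 1 - y ^+ 2) ->
  Num.sqrt (opt_adjustment x) <= A.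
Proof.
move=> A0 cond; have x0 := gt0_x.
apply: sqrt_opt_le => // r mono Vx; apply: tail_bound_main => //; first exact: ltW.
have q0 : 0 < Num.sqrt x by rewrite sqrtr_gt0.
have lq : ln (Num.sqrt x) = l * y ^+ 2.
  have : ln (Num.sqrt x ^+ 2) = L by rewrite sqr_sqrtr// ltW.
  by rewrite lnXn// -log4_sqr; lra.
have -> : 2 * A * Num.sqrt x + 1 = Num.sqrt x * (2 * A + (Num.sqrt x)^-1).
  by rewrite mulrDr mulfV ?gt_eqF//; lra.
rewrite lnM ?posrE// ?lq; first by lra.
have iq0 : 0 < (Num.sqrt x)^-1 by rewrite invr_gt0.
by lra.
Qed.

(* For [x <= 13 / 5] the adjustment [2 * x / ln 2] suffices; [y] is bounded below
   on successive ranges of [x]. *)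
Lemma sqrt_opt_le_2 : Num.sqrt (opt_adjustment x) <= y + 2.
Proof.
have y0 := sqrt_log4_ge0; have A0 : 0 <= y + 2 by lra.
have l2 := @ln2_le R; have l2' := @ln2_ge R.
have x0 := gt0_x.
have lnge (u : R) : 0 < u -> u <= x -> ln u <= L by move=> u0 ux; rewrite ler_ln ?posrE.
have tr c : 0 <= c -> c <= y -> x <= 17 / 50 * (2 + c) ^+ 2 ->
    Num.sqrt (opt_adjustment x) <= y + 2.
  move=> c0 cy xc; apply: sqrt_opt_le_trivial => //.
  have : (2 + c) ^+ 2 <= (y + 2) ^+ 2 by rewrite ler_pXn2r ?nnegrE//; lra.
  have : 17 / 25 * (y + 2) ^+ 2 <= l * (y + 2) ^+ 2 by rewrite ler_wpM2r ?sqr_ge0.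
  by lra.
have [xa|xa] := leP x (4 / 3); first by apply: (tr 0) => //; lra.
have ya : 21 / 50 <= y.
  apply: sqrt_log4_ge; first by lra.
  by have := @ln_ge_sub_inv R (4 / 3); have := lnge (4 / 3); lra.
have [xb|xb] := leP x (39 / 20); first by apply: (tr (21 / 50)) => //; lra.
have yb : 69 / 100 <= y.
  apply: sqrt_log4_ge; first by lra.
  have := @ln_ge_sub_inv R (39 / 40); have := lnge (39 / 20).
  have -> : ln (39 / 20) = l + ln (39 / 40) :> R.
    by rewrite -lnM ?posrE//; try lra; congr ln; lra.
  by lra.
have [xc|xc] := leP x (12 / 5); first by apply: (tr (69 / 100)) => //; lra.
have yc : 39 / 50 <= y.
  apply: sqrt_log4_ge; first by lra.
  have := @ln_ge_sub_inv R (6 / 5); have := lnge (12 / 5).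
  have -> : ln (12 / 5) = l + ln (6 / 5) :> R.
    by rewrite -lnM ?posrE//; try lra; congr ln; lra.
  by lra.
have [xd|xd] := leP x (13 / 5); first by apply: (tr (39 / 50)) => //; lra.
have yd : 81 / 100 <= y.
  apply: sqrt_log4_ge; first by lra.
  have := @ln_ge_sub_inv R (13 / 10); have := lnge (13 / 5).
  have -> : ln (13 / 5) = l + ln (13 / 10) :> R.
    by rewrite -lnM ?posrE//; try lra; congr ln; lra.
  by lra.
apply: sqrt_opt_le_main => //.
have qge : 8 / 5 <= Num.sqrt x.
  by rewrite -(ler_pXn2r (_ : (0 < 2)%N)) ?nnegrE ?sqrtr_ge0 ?sqr_sqrtr//; lra.
have iq : (Num.sqrt x)^-1 <= 5 / 8.
  have -> : 5 / 8 = (8 / 5)^-1 :> R by lra.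
  by rewrite lef_pV2 ?posrE//; lra.
have iq0 : 0 < (Num.sqrt x)^-1 by rewrite invr_gt0; lra.
(* The logarithm is linearised at [25 / 4], the value of [2 * (y + 2) + 5 / 8] at [y = 13 / 16],
   just above the lower end [81 / 100] of the range. *)
pose u : R := (2 * (y + 2) + 5 / 8) * (4 / 25).
have lu : ln u <= u - 1.
  have := @le_ln1Dx R (u - 1); rewrite addrCA subrr addr0; apply; rewrite /u; lra.
have l25 : ln (25 / 4) <= 2 * l + 369 / 800 :> R.
  have -> : ln (25 / 4) = l + (l + ln (25 / 16)) :> R.
    by rewrite -!lnM ?posrE//; try lra; congr ln; lra.
  have := @ln_le_half_sub_inv R (25 / 16).
  by lra.
have : ln (2 * (y + 2) + (Num.sqrt x)^-1) <= ln (25 / 4) + ln u.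
  by rewrite -lnM ?posrE ?ler_ln ?posrE /u//; lra.
rewrite /u in lu *; nra.
Qed.

(** For [A = y + rho] the cross term [2 * rho * y] is at least [20 / 3 * ll], because
    [sqrt L <= 6 / 5 * y]. It absorbs the logarithmic term, at most [ln 2 + ll], and the
    constants. *)
Lemma sqrt_opt_le_loglog : 2 * ln (expR 1 + L) <= Num.sqrt L ->
  Num.sqrt (opt_adjustment x) <= y + 4 * ln (expR 1 + L) / Num.sqrt L.
Proof.
have e2 := @expR1_ge2 R; have L0 := ln_gt0_x; have y0 := sqrt_log4_ge0.
have l2 := @ln2_le R; have l2' := @ln2_ge R; have x0 := gt0_x.
set ll := ln (expR 1 + L); set sL := Num.sqrt L => llL.
have sL2 : sL ^+ 2 = L by rewrite sqr_sqrtr// ltW.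
have sL0 : 0 < sL by rewrite sqrtr_gt0.
have ll1 : 1 <= ll by rewrite -[leLHS]expRK ler_ln ?posrE; lra.
have L4 : 4 <= L by rewrite -sL2; nra.
have llge : 34 / 25 <= ll.
  have : ln 4 <= ll by rewrite ler_ln ?posrE; lra.
  by rewrite ln4E; lra.
set rho := 4 * ll / sL.
have rsL : rho * sL = 4 * ll by rewrite /rho divfK// gt_eqF.
have rho0 : 0 < rho by rewrite /rho divr_gt0//; lra.
have rho2 : rho <= 2 by rewrite /rho ler_pdivrMr//; lra.
have yL := log4_sqr.
have sLy : sL <= 6 / 5 * y.
  have sL00 := ltW sL0; have y60 : 0 <= 6 / 5 * y by lra.
  rewrite -(ler_pXn2r (_ : (0 < 2)%N)) ?nnegrE//.
  by rewrite sL2 -yL exprMn; have := sqr_ge0 y; nra.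
have ry : 10 / 3 * ll <= rho * y by nra.
apply: sqrt_opt_le_main; first by lra.
have q1 : 1 <= Num.sqrt x.
  have xx := x1.
  by rewrite -(ler_pXn2r (_ : (0 < 2)%N)) ?nnegrE ?sqrtr_ge0 ?sqr_sqrtr//; lra.
have iq : (Num.sqrt x)^-1 <= 1 by rewrite invf_le1//; lra.
have iq0 : 0 < (Num.sqrt x)^-1 by rewrite invr_gt0; lra.
have : ln (2 * (y + rho) + (Num.sqrt x)^-1) <= l + ll.
  rewrite -lnM ?posrE//; last lra.
  rewrite ler_ln ?posrE; [|lra|lra].
  nra.
have r2 := sqr_ge0 rho.
have -> : (y + rho) ^+ 2 - 1 - y ^+ 2 = 2 * (rho * y) + rho ^+ 2 - 1 by lra.
have : l * (2 * (10 / 3 * ll) - 1) <= l * (2 * (rho * y) + rho ^+ 2 - 1).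
  by rewrite ler_wpM2l//; lra.
nra.
Qed.

End upper_bound_numerics.

(** * The staircase randomisation *)

Section uniform_probability.
Context {R : realType} (n N : nat).

(** A fresh name, here and for [outcomes], lets the type carry the discrete sigma-algebra, for which
    every function on it is measurable. *)
Definition subsets := {set 'I_N}.
HB.instance Definition _ := Finite.on subsets.
HB.instance Definition _ := isPointed.Build subsets (finset.set0 : {set 'I_N}).
HB.instance Definition _ := @isMeasurable.Build default_measure_display
  subsets discrete_measurable discrete_measurable0
  discrete_measurableC discrete_measurableU.

Definition outcomes := {ffun 'I_n -> {set 'I_N}}.
HB.instance Definition _ := Finite.on outcomes.
HB.instance Definition _ := isPointed.Build outcomes
  ([ffun=> finset.set0] : {ffun 'I_n -> {set 'I_N}}).
HB.instance Definition _ := @isMeasurable.Build default_measure_display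
  outcomes discrete_measurable discrete_measurable0
  discrete_measurableC discrete_measurableU.

Lemma card_outcomes_gt0 : (0 < #|{: outcomes}|)%N.
Proof. by apply/card_gt0P; exists point. Qed.

Lemma inv_card_outcomes_ge0 : 0 <= #|{: outcomes}|%:R^-1 :> R.
Proof. by rewrite invr_ge0 ler0n. Qed.

(** As a scaled finite sum of Dirac masses it inherits its measure structure. *)
Definition uniform : set outcomes -> \bar R :=
  mscale (NngNum inv_card_outcomes_ge0)
    (msum (fun k => \d_(nth point (enum {: outcomes}) k)) #|{: outcomes}|).

HB.instance Definition _ := Measure.on uniform.

Lemma uniformE (A : set outcomes) : uniform A =
  (#|[set w : outcomes | w \in A]%SET|%:R / #|{: outcomes}|%:R)%:E.
Proof.
rewrite /uniform /mscale /= mulrC EFinM; congr (_ * _)%E.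
transitivity (\sum_(k < #|{: outcomes}|)
    (nth point (enum {: outcomes}) k \in A)%:R%:E : \bar R)%E.
  by apply: eq_bigr => k _; exact: diracE.
rewrite sumEFin; congr EFin.
rewrite -(big_mkord xpredT (fun k => (nth point (enum {: outcomes}) k \in A)%:R)).
rewrite cardE -(big_nth point xpredT (fun w : outcomes => (w \in A)%:R)) big_enum/=.
rewrite -sum1_card natr_sum [RHS]big_mkcond/=; apply: eq_bigr => w _.
by rewrite inE; case: (w \in A).
Qed.

Lemma uniform_setT : uniform setT = 1%E.
Proof.
rewrite uniformE; have -> :
    [set w : outcomes | w \in ([set: outcomes]%classic : set outcomes)]%SET = finset.setT.
  by apply/setP => w; rewrite [RHS]inE inE; exact: mem_set.
by rewrite cardsT mulfV// pnatr_eq0 -lt0n card_outcomes_gt0.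
Qed.

HB.instance Definition _ :=
  Measure_isProbability.Build _ _ _ uniform uniform_setT.

Lemma uniform_rectangle (B : 'I_n -> {set subsets}) :
  #|[set w : outcomes | [forall i, w i \in B i]]%SET|%:R / #|{: outcomes}|%:R =
  \prod_i (#|B i|%:R / #|{: subsets}|%:R) :> R.
Proof.
have -> : #|[set w : outcomes | [forall i, w i \in B i]]%SET| = \prod_i #|B i|.
  have -> : #|[set w : outcomes | [forall i, w i \in B i]]%SET| =
      #|family (fun i => mem (B i))|.
    by apply: eq_card => w; rewrite inE; apply/forallP/familyP.
  by rewrite card_family foldrE big_image.
have -> : #|{: outcomes}| = (\prod_(i < n) #|{: subsets}|)%N.
  by rewrite prod_nat_const; exact: card_ffun.
by rewrite !natr_prod -prodf_div.
Qed.

Lemma uniform_independent :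
  independent_components (uniform : probability outcomes R)
    (fun (i : 'I_n) (w : outcomes) => w i : subsets).
Proof.
move=> J A _.
pose B i : {set subsets} := [set s : subsets | s \in A i]%SET.
have s0 : #|{: subsets}|%:R != 0 :> R.
  by rewrite pnatr_eq0 -lt0n; apply/card_gt0P; exists point.
have PJ (J' : {set 'I_n}) :
    uniform (\bigcap_(i in [set` J']) ((fun w : outcomes => w i : subsets) @^-1` A i)) =
    (\prod_(i in J') (#|B i|%:R / #|{: subsets}|%:R))%:E.
  rewrite uniformE; congr EFin.
  (* Taking the full set outside [J'] makes the event a rectangle over all voters. *)
  pose B' i := if i \in J' then B i else finset.setT.
  transitivity (\prod_i (#|B' i|%:R / #|{: subsets}|%:R) : R).
    rewrite -uniform_rectangle; congr (_%:R / _); apply: eq_card => w.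
    rewrite !inE; apply/idP/forallP => [|h].
      rewrite inE => h i; rewrite /B'; case: ifPn => iJ; last by rewrite inE.
      by rewrite inE; apply/mem_set; exact: h.
    rewrite inE => i /= iJ; have := h i; rewrite /B' iJ inE => /set_mem; exact.
  rewrite [RHS]big_mkcond/=; apply: eq_bigr => i _; rewrite /B'; case: ifP => // _.
  by rewrite cardsT mulfV.
apply: etrans (PJ J) _; rewrite -prodEFin; apply: eq_bigr => i _.
have := PJ [set i]%SET; rewrite big_set1 => <-; congr (uniform _).
apply/seteqP; split => [w /(_ i)|w Aw j /=]; last by rewrite inE => /eqP->.
by apply; rewrite /= inE.
Qed.

End uniform_probability.

(* Each of [n] voters independently approves of a uniformly random subset of [N]
   candidates, and [votes z j] counts the approvals of candidate [j].  As it is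
   at most [n], consecutive steps of base height [n] are ordered. *)
Section staircase.
Context {R : realType} (n' N' : nat) (c : R).
Hypothesis c0 : 0 < c.
Local Notation n := n'.+1.
Local Notation N := N'.+1.
Hypothesis cnN : N%:R * n%:R * c <= 1.

(** [Num.truncn] is 0 on negative reals, so the first step extends to minus infinity; [minn] extends
    the last one to plus infinity. *)
Definition step (t : R) : nat := minn (Num.truncn t) N'.

(** As [step] never exceeds [N'], the default value of [inord] is never reached in [staircase]. *)
Definition votes (z : 'I_n -> {set 'I_N}) (j : nat) : R :=
  \sum_(i < n) (inord j \in z i)%:R.

Definition staircase (z : 'I_n -> {set 'I_N}) (t : R) : R :=
  c * (n%:R * (step t)%:R + votes z (step t)).

Lemma votes_ge0 z j : 0 <= votes z j.
Proof. by apply: sumr_ge0 => i _; rewrite ler0n. Qed.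

Lemma votes_le z j : votes z j <= n%:R.
Proof.
rewrite (_ : n%:R = \sum_(i < n) 1); last by rewrite sumr_const card_ord.
by apply: ler_sum => i _; case: (_ \in _); rewrite ?ler01.
Qed.

Lemma staircase_ge0 z t : 0 <= staircase z t.
Proof. by rewrite mulr_ge0 ?(ltW c0)// addr_ge0 ?votes_ge0// mulr_ge0// ler0n. Qed.

Lemma staircase_le1 z t : staircase z t <= 1.
Proof.
apply: le_trans cnN; rewrite /staircase mulrC ler_pM2r//.
apply: (@le_trans _ _ (n%:R * (step t)%:R + n%:R)); first by rewrite lerD2l votes_le.
rewrite -[X in _ + X]mulr1 -mulrDr natr1 mulrC ler_pM2r ?ltr0n// ler_nat.
by rewrite ltnS geq_minr.
Qed.

Lemma staircase_monotone z : monotone_class (staircase z).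
Proof.
split; last by move=> t; rewrite staircase_ge0 staircase_le1.
move=> s t st; rewrite /staircase ler_pM2l//.
have : (step s <= step t)%N by rewrite /step leq_min geq_minr andbT geq_min le_truncn.
rewrite leq_eqVlt => /orP[/eqP->//|lt].
apply: (@le_trans _ _ (n%:R * (step s)%:R + n%:R)); first by rewrite lerD2l votes_le.
rewrite -[X in _ + X]mulr1 -mulrDr natr1; apply: (@le_trans _ _ (n%:R * (step t)%:R)).
  by rewrite ler_pM2l ?ltr0n// ler_nat.
by rewrite lerDl votes_ge0.
Qed.

Lemma measurable_staircase t : measurable_fun setT
  ((fun z => staircase z t) :
    g_sigma_algebraType (cylinders (fun _ : 'I_n => subsets N : measurableType _)) -> R).
Proof.
apply: measurable_funM => //; apply: measurable_funD => //.
apply: measurable_sum => i.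
have mh : measurable_fun setT (fun s : subsets N => (inord (step t) \in s)%:R : R).
  by move=> _ Y _.
exact: (measurableT_comp mh (@measurable_coord _ _ (fun _ => subsets N : measurableType _) i)).
Qed.

Definition ballot (i : 'I_n) (w : outcomes n N) : subsets N := w i.

Lemma measurable_ballot (i : 'I_n) : measurable_fun setT (ballot i).
Proof. by move=> _ Y _. Qed.

HB.instance Definition _ (i : 'I_n) := isMeasurableFun.Build _ _
  (outcomes n N) (subsets N) (ballot i) (measurable_ballot i).

Lemma staircase_bounded : exists K : R, forall z t, `|staircase z t| <= K.
Proof.
by exists 1 => z t; rewrite ger0_norm ?staircase_ge0 ?staircase_le1.
Qed.

Definition staircase_randomisation : randomisation R R :=
  @Randomisation R R (ex_intro _ 0 I) n (ltn0Sn n') _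
    (fun _ : 'I_n => subsets N : measurableType _) staircase
    staircase_bounded measurable_staircase _ (outcomes n N : measurableType _)
    (@uniform R n N : probability (outcomes n N) R)
    (fun i => ballot i : {mfun outcomes n N >-> subsets N})
    (@uniform_independent R n N).

End staircase.

(** * Oscillation, mean and deviation of the staircase *)

Section staircase_properties.
Context {R : realType} (n' N' : nat) (c : R).
Hypothesis c0 : 0 < c.
Local Notation n := n'.+1.
Local Notation N := N'.+1.
Hypothesis cnN : N%:R * n%:R * c <= 1.
Local Notation r := (staircase_randomisation c0 cnN).

Let addlBB (a b e : R) : a + b - (a + e) = b - e. Proof. by lra. Qed.

Let addrBB (a b e : R) : a + b - (e + b) = a - e. Proof. by lra. Qed.

(** One ballot changes a count by at most 1, and replacing an empty ballot by a full one attains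
    this. *)
Lemma staircase_coord_osc (i : 'I_n) : coord_osc r i = c.
Proof.
apply/eqP; rewrite eq_le; apply/andP; split; last first.
  apply: le_trans (@coord_osc_ge _ _ r i 0 (fun=> finset.set0) (finset.setT : {set 'I_N})).
  rewrite /= /staircase -mulrBr addlBB normrM (gtr0_norm c0) ler_peMr ?(ltW c0)//.
  rewrite /votes (bigD1 i)//= dfwithin inE [X in _ - X]big1 => [|j _]; last by rewrite inE.
  rewrite subr0 ger0_norm ?lerDl; last by rewrite addr_ge0// sumr_ge0.
  by rewrite sumr_ge0.
apply: sup_le_ub.
  by exists `|rfun r (dfwith point i point) 0 - rfun r point 0|, 0, point, point.
move=> _ [t [zi [z ->]]]; rewrite /= /staircase -mulrBr addlBB normrM (gtr0_norm c0).
rewrite ler_piMr ?(ltW c0)// /votes (bigD1 i)//= [X in _ - X](bigD1 i)//= dfwithin.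
rewrite (_ : \sum_(j < n | j != i) _ = \sum_(j < n | j != i) (inord (step N' t) \in z j)%:R); last first.
  by apply: eq_bigr => j ji; rewrite dfwithout// eq_sym.
rewrite addrBB; case: (_ \in _); case: (_ \in _); rewrite ?subrr ?subr0 ?sub0r ?normr0 ?normrN ?normr1//.
Qed.

Lemma staircase_total_osc : total_osc r = n%:R * c ^+ 2.
Proof.
rewrite /total_osc (eq_bigr (fun=> c ^+ 2)) => [|i _]; last by rewrite staircase_coord_osc.
by rewrite sumr_const card_ord mulr_natl.
Qed.

(* Complementing all ballots preserves the uniform probability and exchanges
   [votes] with [n - votes], which yields the mean. *)
Definition flip (w : outcomes n N) : outcomes n N :=
  ([ffun i => ~: (w i)] : {ffun 'I_n -> {set 'I_N}}).

Lemma flipK : involutive flip.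
Proof. by move=> w; apply/ffunP => i; rewrite !ffunE finset.setCK. Qed.

Lemma uniform_flip (A : set (outcomes n N)) :
  @uniform R n N (flip @^-1` A) = uniform A.
Proof.
rewrite !uniformE; congr ((_%:R / _)%:E).
rewrite -[RHS](card_preimset _ (inv_inj flipK)); apply: eq_card => w.
by rewrite !inE; apply/idP/idP => /set_mem ?; exact/mem_set.
Qed.

Lemma measurable_flip : measurable_fun setT flip. Proof. by move=> _ Y _. Qed.

Lemma Rintegral_flip (X : outcomes n N -> R) :
  \int[@uniform R n N]_w X (flip w) = \int[@uniform R n N]_w X w.
Proof.
rewrite /Rintegral; congr fine.
have mX : measurable_fun setT (EFin \o X) by move=> _ Y _.
have mXf : measurable_fun setT (X \o flip) by move=> _ Y _.
have iX : (@uniform R n N).-integrable setT ((EFin \o X) \o flip).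
  apply: (@bounded_integrable _ _ _ (@uniform R n N) (\sum_w `|X w|) _ mXf) => w.
  by rewrite (bigD1 (flip w))//= lerDl sumr_ge0.
rewrite -(@integral_pushforward _ _ _ _ _ _ measurable_flip (@uniform R n N) setT _ mX iX)//.
by apply: eq_measure_integral => [_ Y _|mf A mA AT]; [|exact: (uniform_flip A)].
Qed.

Lemma votes_flip w j : votes (flip w) j = n%:R - votes w j :> R.
Proof.
rewrite (_ : n%:R = \sum_(i < n) 1); last by rewrite sumr_const card_ord.
rewrite -sumrB; apply: eq_bigr => i _; rewrite ffunE inE.
by case: (_ \in _); rewrite ?subrr ?subr0.
Qed.

Lemma staircase_mean t : mean_fun r t = c * (n%:R * (step N' t)%:R + n%:R / 2).
Proof.
have iF : (@uniform R n N).-integrable setT (EFin \o random_fun r t).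
  have mono : randomised_monotone r := @staircase_monotone R n' N' c c0 cnN.
  exact: (random_fun_integrable mono t).
have mFf : measurable_fun setT (random_fun r t \o flip) by move=> _ Y _.
have iFf : (@uniform R n N).-integrable setT (EFin \o (random_fun r t \o flip)).
  apply: (@bounded_integrable _ _ _ (@uniform R n N) 1 _ mFf) => w.
  by rewrite ger0_norm ?staircase_ge0 ?staircase_le1.
have : mean_fun r t + \int[@uniform R n N]_w random_fun r t (flip w) =
    2 * (c * (n%:R * (step N' t)%:R + n%:R / 2)).
  rewrite /mean_fun /= -RintegralD//.
  rewrite -[RHS](@Rintegral_probability_cst R _ _ (@uniform R n N)).
  apply: eq_Rintegral => w _.
  rewrite -[X in _ + X]/(c * (n%:R * (step N' t)%:R + votes (flip w) (step N' t))).
  rewrite -[X in X + _]/(c * (n%:R * (step N' t)%:R + votes w (step N' t))).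
  by rewrite votes_flip; lra.
by rewrite Rintegral_flip -/(mean_fun r t); lra.
Qed.

(** The approver sets that keep a candidate's step closer than [c * k / 2] to its mean. *)
Definition balanced (k : nat) : {set {set 'I_n}} :=
  [set B : {set 'I_n} | `|2 * #|B|%:R - n%:R| < k%:R :> R]%SET.

(** Passes from the candidates approved by each voter to the approvers of each candidate. Being a
    bijection, it makes the approver sets of distinct candidates independent and uniform. *)
Definition transpose (m p : nat) (w : outcomes m p) : outcomes p m :=
  ([ffun j => [set i | j \in w i]%SET] : {ffun 'I_p -> {set 'I_m}}).

Lemma transposeK m p : cancel (@transpose m p) (@transpose p m).
Proof.
by move=> w; apply/ffunP => i; apply/setP => j; rewrite ffunE inE ffunE inE.
Qed.

Lemma votesE (w : outcomes n N) (j : 'I_N) :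
  votes w j = #|transpose w j|%:R :> R.
Proof.
rewrite /votes inord_val -sum1_card natr_sum [RHS]big_mkcond/=; apply: eq_bigr => i _.
by rewrite ffunE inE; case: (_ \in _).
Qed.

Lemma prob_all_balanced k :
  @uniform R n N [set w | forall j : 'I_N, transpose w j \in balanced k] =
  ((#|balanced k|%:R / 2 ^+ n) ^+ N)%:E.
Proof.
rewrite uniformE; congr EFin.
have cT : #|{: outcomes n N}| = #|{: outcomes N n}|.
  by apply: (bij_eq_card (Bijective (@transposeK n N) (@transposeK N n))).
transitivity (\prod_(j < N) (#|balanced k|%:R / #|{: subsets n}|%:R) : R); last first.
  have -> : #|{: subsets n}| = (2 ^ n)%N.
    by rewrite -cardsT -finset.powersetT card_powerset cardsT card_ord.
  by rewrite prodr_const card_ord natrX.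
rewrite -(@uniform_rectangle R N n (fun=> balanced k)) cT; congr (_%:R / _).
rewrite -[LHS](card_imset _ (can_inj (@transposeK n N))); apply: eq_card => v.
rewrite inE; apply/imsetP/forallP => [[w + ->] j|h].
  by rewrite inE => /set_mem; exact.
exists (transpose v); last by rewrite transposeK.
rewrite inE; apply/mem_set => j; rewrite transposeK; exact: h.
Qed.

(** Unless every candidate is balanced, the deviation at some integer [t = j] reaches the
    threshold. *)
Lemma staircase_tail k :
  ((1 - (#|balanced k|%:R / 2 ^+ n) ^+ N)%:E <=
   prob r [set w | (c * (k%:R / 2) <= sup_deviation r w)%R])%E.
Proof.
have mono : randomised_monotone r := @staircase_monotone R n' N' c c0 cnN.
rewrite EFinB -prob_all_balanced.
have -> : (1%:E - uniform [set w | forall j : 'I_N, transpose w j \in balanced k] =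
    @uniform R n N (~` [set w | forall j : 'I_N, transpose w j \in balanced k]))%E.
  by rewrite probability_setC.
apply: le_measure; rewrite ?inE//.
move=> w /= /existsNP[j]; rewrite inE => /negP; rewrite -leNgt => kj.
apply: le_trans (deviation_le_sup mono j%:R w).
have sj : step N' (j%:R : R) = j by rewrite /step natrK; apply/minn_idPl; rewrite -ltnS.
rewrite /deviation staircase_mean sj.
have -> : random_fun r j%:R w = c * (n%:R * j%:R + votes w j) by rewrite -{2}sj -{3}sj.
rewrite -mulrBr normrM (gtr0_norm c0) ler_pM2l// votesE.
have -> : n%:R * j%:R + #|transpose w j|%:R - (n%:R * j%:R + n%:R / 2) =
   (2 * #|transpose w j|%:R - n%:R) / 2 :> R by lra.
by rewrite normrM [`|2^-1|]ger0_norm// ler_pM2r.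
Qed.

End staircase_properties.

(** * Lower bound *)

Section lower_bound.
Context {R : realType}.

Lemma adjustment_ge (n' N' k : nat) (x eps : R) (U : R -> R) :
  0 < x -> (N'.+1 ^ 2 * n'.+1)%:R <= x -> @adjustment R U -> 0 < eps ->
  2 * expR (- 2 * eps ^+ 2) <
    1 - (#|@balanced R n' k|%:R / 2 ^+ n'.+1) ^+ N'.+1 ->
  k%:R / 2 < eps * Num.sqrt n'.+1%:R * Num.sqrt (U x).
Proof.
move=> x0 Nnx [_ adjU] eps0 hprob; rewrite ltNge; apply/negP => hk.
set n := n'.+1 in Nnx hk *; set N := N'.+1 in Nnx *.
have sn0 : 0 < Num.sqrt (n%:R : R) by rewrite sqrtr_gt0 ltr0n.
have sx0 : 0 < Num.sqrt x by rewrite sqrtr_gt0.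
have sn2 : Num.sqrt (n%:R : R) ^+ 2 = n%:R by rewrite sqr_sqrtr.
have sx2 : Num.sqrt x ^+ 2 = x by rewrite sqr_sqrtr// ltW.
(* Determined by [n * c ^+ 2 = x^-1], that is, effective sample size [x]; the constraint
   [N * n * c <= 1] then reads [N ^ 2 * n <= x]. *)
pose c : R := (Num.sqrt n%:R * Num.sqrt x)^-1.
have c0 : 0 < c by rewrite invr_gt0 mulr_gt0.
have cnN : N%:R * n%:R * c <= 1.
  rewrite ler_pdivrMr ?mulr_gt0// mul1r -{1}sn2 expr2 mulrCA ler_pM2l//.
  rewrite -(ler_pXn2r (_ : (0 < 2)%N)) ?nnegrE ?mulr_ge0 ?(ltW sn0) ?(ltW sx0)//.
  by rewrite exprMn sn2 sx2; move: Nnx; rewrite natrM natrX.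
pose r := staircase_randomisation c0 cnN.
have Vr : total_osc r = x^-1.
  rewrite staircase_total_osc /c exprVn exprMn sn2 sx2 invfM mulrA mulfV ?mul1r//.
have eff : eff_size r = x%:E.
  rewrite /eff_size -/(total_osc r) Vr inver invrK.
  by rewrite invr_eq0 gt_eqF.
have mono : randomised_monotone r := staircase_monotone c0 cnN.
have := adjU r mono; rewrite eff /= ltry => /(_ isT eps eps0).
apply/negP; rewrite -ltNge; apply: (@lt_le_trans _ _
  ((1 - (#|@balanced R n' k|%:R / 2 ^+ n) ^+ N)%:E)); first by rewrite lte_fin.
apply: (le_trans (staircase_tail c0 cnN k)); apply: le_measure; rewrite ?inE.
- exact: measurable_sup_deviation_ge.
- exact: measurable_tail.
- move=> w /= cw; have : Num.sqrt x * (c * (k%:R / 2)) <= Num.sqrt x * sup_deviation r w.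
    by rewrite ler_pM2l.
  apply: le_trans; rewrite -(ler_pM2l sn0).
  have -> : Num.sqrt n%:R * (Num.sqrt x * (c * (k%:R / 2))) =
      (Num.sqrt n%:R * Num.sqrt x * c) * (k%:R / 2) by lra.
  by rewrite mulfV ?gt_eqF ?mulr_gt0// mul1r; move: hk; lra.
Qed.

Lemma sqrt_opt_ge (n' N' k : nat) (x eps B : R) :
  1 < x -> (N'.+1 ^ 2 * n'.+1)%:R <= x -> 0 < eps -> 0 <= B ->
  2 * expR (- 2 * eps ^+ 2) <
    1 - (#|@balanced R n' k|%:R / 2 ^+ n'.+1) ^+ N'.+1 ->
  B * eps * Num.sqrt n'.+1%:R <= k%:R / 2 -> B <= Num.sqrt (opt_adjustment x).
Proof.
move=> x1 Nnx eps0 B0 hprob hB; have x0 : 0 < x by lra.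
rewrite -[leLHS]ger0_norm// -sqrtr_sqr; apply: ler_wsqrtr.
(* The trivial adjustment shows that the infimum is over a nonempty set, and so not the default
   value 0. *)
have [_ hinf] : opt_adjustment x <= 2 * x / ln 2 /\ has_inf [set U x | U in @adjustment R].
  apply: opt_adjustment_le => //.
    by rewrite divr_ge0 ?(ltW ln2_gt0)// mulr_ge0// ltW.
  by move=> r mono Vx; exact: tail_bound_trivial.
apply: lb_le_inf; first exact: hinf.1.
move=> _ [U adjU <-]; have U0 : 0 <= U x by apply: adjU.1; exact: ltW.
rewrite -[leRHS]sqr_sqrtr// ler_pXn2r ?nnegrE ?sqrtr_ge0//.
have := adjustment_ge x0 Nnx adjU eps0 hprob => /(le_lt_trans hB).
have -> : B * eps * Num.sqrt n'.+1%:R = eps * Num.sqrt n'.+1%:R * B by lra.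
rewrite ltr_pM2l => [/ltW//|].
by rewrite mulr_gt0// sqrtr_gt0 ltr0n.
Qed.

Lemma le_expR_pow (q s : R) N : 0 <= q -> q <= 1 - s -> q ^+ N <= expR (- (N%:R * s)).
Proof.
move=> q0 qs; rewrite -mulrN expRM_natl.
rewrite lerXn2r ?nnegrE ?expR_ge0// (le_trans qs)//.
by have := expR_ge1Dx (- s).
Qed.

(** Sets of size [a] or [n - a] are not balanced, and [n < 2 * a] keeps these two classes, of
    ['C(n, a)] elements each, disjoint. *)
Lemma card_balanced_le n' a k : (n'.+1 < a.*2)%N -> (a <= n'.+1)%N ->
  (k + n'.+1 <= a.*2)%N ->
  #|@balanced R n' k|%:R / 2 ^+ n'.+1 <= 1 - 2 * 'C(n'.+1, a)%:R / 2 ^+ n'.+1 :> R.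
Proof.
set n := n'.+1 => na an kn.
have p0 : 0 < 2 ^+ n :> R by rewrite exprn_gt0.
rewrite ler_pdivrMr// mulrBl mul1r divfK ?gt_eqF// lerBrDr.
rewrite -natrM -natrX -natrD ler_nat.
pose D b : {set {set 'I_n}} := [set B : {set 'I_n} | #|B| == b]%SET.
have cD b : #|D b| = 'C(n, b) by rewrite card_draws card_ord.
have -> : (2 * 'C(n, a) = #|D a :|: D (n - a)%N|)%N.
  rewrite cardsU !cD bin_sub// (_ : D a :&: D (n - a)%N = finset.set0) ?cards0 ?subn0 ?addnn ?mul2n//.
  by apply/setP => B; rewrite !inE; apply/negP => /andP[/eqP-> /eqP]; lia.
have -> : (2 ^ n = #|(finset.setT : {set {set 'I_n}})|)%N.
  by rewrite -finset.powersetT card_powerset cardsT card_ord.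
have disj : @balanced R n' k :&: (D a :|: D (n - a)%N) = finset.set0.
  apply/setP => B; rewrite !inE; apply/negP => /andP[bal cB]; move: bal.
  apply/negP; rewrite -leNgt ler_normr; apply/orP.
  move/orP: cB => [/eqP->|/eqP->]; [left|right].
    by rewrite lerBrDr -natrM -natrD ler_nat mul2n.
  rewrite natrB// -/n; move: kn; rewrite -(ler_nat R) natrD -mul2n natrM.
  by rewrite -/n; lra.
have := subset_leq_card (finset.subsetT (@balanced R n' k :|: (D a :|: D (n - a)%N))).
by rewrite cardsU disj cards0 subn0.
Qed.

(** The bound [4 ^ M <= 2 * sqrt M * 'C(2 * M, M)], squared to stay in [nat]. The induction step
    amounts to [4 * m * (m + 1) <= (2 * m + 1) ^ 2]. *)
Lemma central_binomial_ge M : (0 < M)%N -> (16 ^ M <= 4 * M * 'C(M.*2, M) ^ 2)%N.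
Proof.
elim: M => // -[_ _|M ih _]; first by [].
have {ih} := ih isT; set m := M.+1.
have e : (m.+1 * 'C(m.+1.*2, m.+1) = 2 * (m.*2.+1 * 'C(m.*2, m)))%N.
  have h1 := mul_bin_diag m.*2.+2 m; have h2 := mul_bin_down m.*2.+1 m.
  rewrite /= in h1 h2; rewrite doubleS -h1 h2.
  have -> : (m.*2.+1 - m = m.+1)%N by lia.
  by rewrite mulnA; congr (_ * _)%N; lia.
rewrite (expnS 16); move: e; set a := 'C(_, _); set b := 'C(_, _); set p := (16 ^ m)%N.
rewrite -muln2 => e ih; rewrite -(leq_pmul2l (ltn0Sn m)).
have -> : (m.+1 * (4 * m.+1 * a ^ 2) = 4 * (m.+1 * a) ^ 2)%N by rewrite expnMn; lia.
apply: (@leq_trans (m.+1 * (16 * (4 * m * b ^ 2)))).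
  by rewrite !leq_mul2l ih !orbT.
have -> : (m.+1 * (16 * (4 * m * b ^ 2)) = (64 * (m.+1 * m)) * b ^ 2)%N by lia.
have -> : (4 * (m.+1 * a) ^ 2 = (16 * (m * 2).+1 ^ 2) * b ^ 2)%N.
  by rewrite e !expnMn; lia.
by rewrite leq_mul2r; apply/orP; right; nia.
Qed.

(** The fraction is the ratio of ['C(2 * m, m + h + 1)] to ['C(2 * m, m + h)]; [ln_le_half_sub_inv]
    is applied to its inverse. *)
Lemma ratio_ge_expR (m h D : R) : 0 <= h -> h < m -> 0 < D ->
  D * m <= m ^+ 2 - (h + 1) ^+ 2 ->
  expR (- ((2 * h + 1) / D)) <= (m - h) / (m + h + 1).
Proof.
move=> h0 hm D0 Dm.
have mh : 0 < m - h by lra.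
have mh1 : 0 < m + h + 1 by lra.
have u1 : 1 <= (m + h + 1) / (m - h) by rewrite ler_pdivlMr//; lra.
have -> : (m - h) / (m + h + 1) = expR (- ln ((m + h + 1) / (m - h))).
  by rewrite expRN lnK ?posrE ?divr_gt0// invf_div.
rewrite ler_expR lerN2 (le_trans (ln_le_half_sub_inv u1))// invf_div.
have -> : ((m + h + 1) / (m - h) - (m - h) / (m + h + 1)) / 2 =
    (2 * m + 1) * (2 * h + 1) / (2 * ((m + h + 1) * (m - h))).
  have -> : (2 * m + 1) * (2 * h + 1) =
    (m + h + 1) * (m + h + 1) - (m - h) * (m - h) by lra.
  have ha : (m + h + 1) * (m + h + 1)^-1 = 1 by rewrite mulfV// gt_eqF.
  have hb : (m - h) * (m - h)^-1 = 1 by rewrite mulfV// gt_eqF.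
  rewrite !invfM; move: ha hb; set a := m + h + 1; set b := m - h.
  set A := a^-1; set B := b^-1 => ha hb.
  have -> : (a * a - b * b) * (2^-1 * (A * B)) = (a * B * (a * A) - b * A * (b * B)) / 2 by lra.
  by rewrite ha hb !mulr1.
rewrite ler_pdivrMr ?mulr_gt0// mulrAC ler_pdivlMr//.
have Dlem : D <= m by rewrite -(ler_pM2r (_ : 0 < m)); nra.
have key : (2 * m + 1) * D <= 2 * ((m + h + 1) * (m - h)) by nra.
have h1 : 0 <= 2 * h + 1 by lra.
by have := ler_wpM2r h1 key; lra.
Qed.

Lemma binomial_tail_ge (M H : nat) (D : R) : (H < M)%N -> 0 < D ->
  D * M%:R <= M%:R ^+ 2 - H%:R ^+ 2 ->
  'C(M.*2, M)%:R * expR (- (H%:R ^+ 2 / D)) <= 'C(M.*2, M + H)%:R :> R.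
Proof.
move=> HM D0; elim: H HM => [|h ih] hM DM.
  by rewrite addn0 expr0n/= mul0r oppr0 expR0 mulr1.
have {}ih := ih (ltnW hM).
have h0 : 0 <= h%:R :> R by exact: ler0n.
have hm : h%:R < M%:R :> R by rewrite ltr_nat ltnW.
have DM' : D * M%:R <= M%:R ^+ 2 - h%:R ^+ 2.
  by apply: (le_trans DM); rewrite -natr1; nra.
have rat := ratio_ge_expR h0 hm D0.
have {}rat := rat ltac:(by move: DM; rewrite -natr1).
have e : 'C(M.*2, M + h.+1)%:R = 'C(M.*2, M + h)%:R * ((M%:R - h%:R) / (M%:R + h%:R + 1)) :> R.
  have pos : 0 < M%:R + h%:R + 1 :> R by lra.
  apply: (mulIf (negbT (gt_eqF pos))); rewrite -[RHS]mulrA divfK ?gt_eqF//.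
  have := congr1 (fun i : nat => i%:R : R) (mul_bin_left M.*2 (M + h)).
  have -> : (M.*2 - (M + h) = M - h)%N by lia.
  rewrite !natrM natrB ?(ltnW (ltnW hM))// addnS -natr1 natrD => e.
  by rewrite mulrC e mulrC.
rewrite e -natr1.
have -> : - ((h%:R + 1) ^+ 2 / D) = - (h%:R ^+ 2 / D) + - ((2 * h%:R + 1) / D) by lra.
rewrite expRD mulrA; apply: ler_pM => //; rewrite ?expR_ge0//.
exact: ih.
Qed.

End lower_bound.

(** * Lower bound by unanimous votes, and an estimate of [ln (ln x)] *)

Section lower_bound_numerics.
Context {R : realType}.
Variables (x : R) (x1 : 1 < x).
Local Notation L := (ln x).
Local Notation l := (@ln R 2).
Local Notation y := (Num.sqrt (log4 x)).

Lemma pow4_le j : j%:R <= y ^+ 2 -> (4 ^ j)%:R <= x.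
Proof.
move=> jy; have x0 := gt0_x x1.
rewrite -[x]lnK ?posrE// -(log4_sqr x1) natrX.
have -> : 4 = expR (2 * l) :> R by rewrite -ln4E lnK ?posrE.
by rewrite -expRM_natl ler_expR mulrC ler_pM2l// mulr_gt0 ?ln2_gt0.
Qed.

(* [2 ^ (n + 2)] candidates make a unanimous vote on one of them very likely. *)
Lemma sqrt_opt_ge_unanimous n' (B : R) :
  (4 ^ n'.+3 * n'.+1)%:R <= x -> 0 <= B -> 36 / 25 * B ^+ 2 <= n'.+1%:R ->
  B <= Num.sqrt (opt_adjustment x).
Proof.
move=> nx B0 Bn; have l2 := @ln2_le R; set n := n'.+1 in nx Bn *.
pose N' := (2 ^ n'.+3).-1.
have NE : N'.+1 = (2 ^ n'.+3)%N by rewrite prednK// expn_gt0.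
have sn2 : Num.sqrt (n%:R : R) ^+ 2 = n%:R by rewrite sqr_sqrtr.
have sn0 : 0 <= Num.sqrt (n%:R : R) by exact: sqrtr_ge0.
(* [(3 / 5) ^ 2] slightly exceeds [ln 2 / 2]. A unanimous count deviates by [n / 2], whence the
   factor [36 / 25 = 4 * (3 / 5) ^ 2]. *)
apply: (@sqrt_opt_ge _ n' N' n x (3 / 5) B) => //.
- by rewrite (_ : N'.+1 ^ 2 = 4 ^ n'.+3)%N// NE -expnM (mulnC _ 2) expnM.
- have bal : #|@balanced R n' n|%:R / 2 ^+ n <= 1 - 2 / 2 ^+ n :> R.
    have := @card_balanced_le R n' n n; rewrite binn mulr1; apply; rewrite -/n; lia.
  have bal0 : 0 <= #|@balanced R n' n|%:R / 2 ^+ n :> R by rewrite divr_ge0 ?exprn_ge0.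
  have := le_expR_pow N'.+1 bal0 bal; rewrite NE natrX.
  have -> : 2 ^+ n'.+3 * (2 / 2 ^+ n) = 8 :> R.
    rewrite /n 2!exprS; set t := 2 ^+ n'.+1.
    have tt : t * t^-1 = 1 by rewrite mulfV// expf_neq0.
    have -> : 2 * (2 * t) * (2 / t) = 8 * (t * t^-1) by lra.
    by rewrite tt mulr1.
  rewrite -NE => h.
  have e8 : expR (- 8) <= 256^-1 :> R.
    rewrite expRN lef_pV2 ?posrE ?expR_gt0 ?ltr0n//.
    have -> : 8 = 8%:R * 1 :> R by rewrite mulr1.
    have -> : 256 = 2 ^+ 8 :> R by rewrite -natrX.
    by rewrite expRM_natl lerXn2r ?nnegrE ?expR_ge0// expR1_ge2.
  have e18 : 2 * expR (- 2 * (3 / 5) ^+ 2) <= 50 / 51 :> R.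
    have -> : - 2 * (3 / 5) ^+ 2 = - l + - (18 / 25 - l) :> R by lra.
    rewrite expRD expRN lnK ?posrE// mulrA mulfV// mul1r expRN.
    have -> : 50 / 51 = (51 / 50)^-1 :> R by lra.
    rewrite lef_pV2 ?posrE ?expR_gt0//; have := expR_ge1Dx (18 / 25 - l); lra.
  apply: (le_lt_trans e18); apply: (@lt_le_trans _ _ (1 - 256^-1)); first lra.
  by rewrite lerD2l lerN2; apply: (le_trans h).
- have Bs : 6 / 5 * B <= Num.sqrt n%:R.
    rewrite -(ler_pXn2r (_ : (0 < 2)%N)) ?nnegrE//; [|lra].
    by rewrite sn2 exprMn; lra.
  rewrite -/n -[X in _ <= X / 2]sn2; move: Bs sn0; set s := Num.sqrt _ => Bs sn0.
  by nra.
Qed.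

(** One voter is enough up to [y = 14 / 5]. From there to [y = 8] more than [y ^+ 2 - 6] voters are
    available, and [36 / 25 * (y - 17 / 10) ^+ 2 <= y ^+ 2 - 6]. *)
Lemma sqrt_opt_ge_small (rho : R) : y <= 8 -> rho <= y ->
  2 <= rho \/ (17 / 10 <= rho /\ 14 / 5 < y) ->
  y - rho <= Num.sqrt (opt_adjustment x).
Proof.
move=> y8 rhoy hrho; have y0 := sqrt_log4_ge0 x.
have [y28|y28] := leP y (14 / 5).
  have rho2 : 2 <= rho by case: hrho => [//|[_]]; lra.
  apply: (@sqrt_opt_ge_unanimous 0); [|lra|nra].
  by rewrite muln1; apply: (@pow4_le 3); nra.
have rho17 : 17 / 10 <= rho by case: hrho => [|[]]; lra.
pose t := Num.truncn (y ^+ 2).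
have /andP[tle tgt] := truncn_itv (sqr_ge0 y).
have t7 : (7 <= t)%N by rewrite truncn_ge_nat ?sqr_ge0//; nra.
have t64 : (t <= 64)%N by rewrite -ltnS truncn_lt_nat ?sqr_ge0//; nra.
(* This makes [n = t - 5] voters; as [n <= 4 ^ 3], [4 ^ (n + 2) * n <= 4 ^ t <= x]. *)
pose n' := (t - 6)%N.
have nt : (n'.+1 + 5)%N = t by rewrite addSnnS (subnK (ltnW t7)).
apply: (@sqrt_opt_ge_unanimous n'); [|lra|].
- apply: le_trans (@pow4_le t tle); rewrite ler_nat -nt.
  have -> : (n'.+1 + 5 = n'.+3 + 3)%N by rewrite (addnC _ 5) (addnC _ 3).
  rewrite expnD leq_mul2l; apply/orP; right.
  have -> : (4 ^ 3 = 64)%N by [].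
  by rewrite -(leq_add2r 5) nt (leq_trans t64).
- have : y ^+ 2 - 6 <= n'.+1%:R.
    by move: tgt; rewrite -/t -nt -!natr1 natrD -natr1; lra.
  apply: le_trans; nra.
Qed.

(** [L <= 7 / 5 * y ^+ 2], and [ln y] is bounded by its tangent at 8. *)
Lemma ln_ln_le : 8 <= y -> ln L <= 13 / 5 + y / 4.
Proof.
move=> y8; have l2 := @ln2_le R; have L0 := ln_gt0_x x1.
have yL := log4_sqr x1.
have Lle : L <= 7 / 5 * (y * y) by rewrite -[in leLHS]yL; nra.
have ly : ln y <= 3 * l + y / 8 - 1.
  have -> : y = 8 * (y / 8) by lra.
  rewrite lnM ?posrE//; last lra.
  rewrite ln8E.
  have := @le_ln1Dx R (y / 8 - 1); rewrite addrCA subrr addr0; lra.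
have : ln L <= ln (7 / 5) + (ln y + ln y).
  have yy : 0 < y * y by rewrite mulr_gt0; lra.
  rewrite -!lnM ?posrE; try lra.
  by rewrite ler_ln ?posrE//; lra.
have := @le_ln1Dx R (2 / 5); have -> : 1 + 2 / 5 = 7 / 5 :> R by lra.
by lra.
Qed.

End lower_bound_numerics.

(** * Lower bound by binomial tails *)

Section large_sample.
Context {R : realType}.
Implicit Types (x y B L k p : R).

(** The central coefficient loses a factor [2 * sqrt M], the shift by [H] a factor
    [expR (H ^ 2 / (M - k))]; [2 / 7] covers the excess of [M * k / (M - k)] over [k]. *)
Lemma shifted_binomial_ge (M' H : nat) k : (H < M'.+1)%N -> 0 < M'.+1%:R - k ->
  H%:R ^+ 2 <= M'.+1%:R * k -> 7 * k ^+ 2 + 2 * k <= 2 * M'.+1%:R ->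
  expR (- (k + 2 / 7)) <=
    (2 * 'C(M'.+1.*2, M'.+1 + H)%:R / 2 ^+ M'.+1.*2) * Num.sqrt M'.+1%:R.
Proof.
set M := M'.+1 => HM D0 H2 kM.
have M0 : 0 < M%:R :> R by rewrite ltr0n.
have DM : (M%:R - k) * M%:R <= M%:R ^+ 2 - H%:R ^+ 2 by lra.
have HD : H%:R ^+ 2 / (M%:R - k) <= k + 2 / 7.
  by rewrite ler_pdivrMr// (le_trans H2)//; lra.
have bin : 'C(M.*2, M)%:R * expR (- (k + 2 / 7)) <= 'C(M.*2, M + H)%:R :> R.
  apply: le_trans (binomial_tail_ge HM D0 DM).
  by rewrite ler_wpM2l ?ler0n// ler_expR lerN2.
pose sM := Num.sqrt (M%:R : R).
have sM2 : sM ^+ 2 = M%:R by rewrite sqr_sqrtr// ltW.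
have sM0 : 0 <= sM by exact: sqrtr_ge0.
have cen : 4 ^+ M <= 2 * sM * 'C(M.*2, M)%:R.
  rewrite -(ler_pXn2r (_ : (0 < 2)%N)) ?nnegrE ?exprn_ge0 ?mulr_ge0 ?ler0n//.
  have := central_binomial_ge (ltn0Sn M'); rewrite -/M -(ler_nat R) => h.
  rewrite -exprM mulnC exprM (_ : 4 ^+ 2 = 16%:R :> R); last by rewrite -natrX.
  move: h; rewrite natrX => /le_trans; apply.
  by rewrite !exprMn sM2 !natrM; lra.
have p4 : 2 ^+ M.*2 = 4 ^+ M :> R.
  by rewrite -mul2n exprM; congr (_ ^+ _); rewrite -natrX.
rewrite p4 -/sM mulrAC ler_pdivlMr ?exprn_gt0//.
have h1 := ler_wpM2l (expR_ge0 (- (k + 2 / 7))) cen.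
have h2 := ler_wpM2l sM0 bin.
apply: (le_trans h1).
move: h2; set a := expR _; set b := 'C(M.*2, M)%:R; set e := _%:R.
by lra.
Qed.

(** The number of steps is the integer part of [sqrt (x / (2 * M))]. In [k], [L / 2] is
    [ln (sqrt x)], and [3 * ln L] pays one factor [L] each for [sqrt (2 * M)], for [sqrt M] in the
    tail bound and for the target [L]. *)
Lemma exists_row_count x L k p (M : nat) : 1 < x -> L = ln x -> 87 <= L ->
  k = L / 2 - 3 * ln L - 3 / 2 -> 0 <= k ->
  L ^+ 2 < M%:R -> M%:R <= L ^+ 2 + 1 ->
  expR (- (k + 2 / 7)) <= p * Num.sqrt M%:R ->
  exists N : nat, (N.+1 ^ 2 * M.*2)%:R <= x /\ L <= N.+1%:R * p.
Proof.
move=> x1 LE L87 kE k0 Mgt Mle; have l2 := @ln2_le R.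
have x0 : 0 < x by exact: lt_trans x1.
have M0 : 0 < M%:R :> R by rewrite (le_lt_trans _ Mgt)// sqr_ge0.
set E := expR _; set sM := Num.sqrt _ => Ep.
have sM2 : sM ^+ 2 = M%:R by rewrite sqr_sqrtr// ltW.
have sM0 : 0 < sM by rewrite sqrtr_gt0.
have E0 : 0 < E := expR_gt0 _.
pose q := Num.sqrt x; pose s2 := Num.sqrt (2 * M%:R : R).
have q0 : 0 < q by rewrite sqrtr_gt0.
have s20 : 0 < s2 by rewrite sqrtr_gt0 mulr_gt0.
have s22 : s2 ^+ 2 = 2 * M%:R by rewrite sqr_sqrtr// mulr_ge0// ltW.
have q2 : q ^+ 2 = x by rewrite sqr_sqrtr// ltW.
have qE : q = expR (L / 2).
  rewrite -[RHS]ger0_norm ?expR_ge0// -sqrtr_sqr; congr Num.sqrt.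
  rewrite -expRM_natl -[LHS]lnK ?posrE// -LE; congr expR; lra.
(* [17 / 14 = 3 / 2 - 2 / 7] is what remains of the constants in [k] and in the tail exponent. *)
have e3 : 3 <= expR (17 / 14) :> R.
  have -> : 17 / 14 = ln 2 + (17 / 14 - ln 2) :> R by lra.
  by rewrite expRD lnK ?posrE//; have := expR_ge1Dx (17 / 14 - ln 2 : R); lra.
have L0 : 0 < L by lra.
have L30 : 0 <= L ^+ 3 by rewrite exprn_ge0// ltW.
have qL : 3 * L ^+ 3 <= q * E.
  rewrite qE -expRD.
  have -> : L / 2 + - (k + 2 / 7) = 3 * ln L + 17 / 14 by rewrite kE; lra.
  by rewrite expRD (expRM_natl 3) lnK ?posrE// mulrC ler_wpM2l.
have ss : s2 * sM <= 10 / 7 * M%:R.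
  have ss0 : 0 <= s2 * sM by rewrite mulr_ge0// ltW.
  have m0 : 0 <= 10 / 7 * M%:R :> R by rewrite mulr_ge0// ltW.
  rewrite -(ler_pXn2r (_ : (0 < 2)%N)) ?nnegrE//.
  rewrite !exprMn s22 sM2; have := sqr_ge0 (M%:R : R); lra.
have E1 : E <= 1 by rewrite expR_le1; lra.
have LL : 87 * L <= L ^+ 2 by rewrite expr2 ler_wpM2r// ltW.
have L3 : 87 * L ^+ 2 <= L ^+ 3 by rewrite (exprS L 2) ler_wpM2r ?sqr_ge0.
have s2L : s2 <= 2 * L.
  rewrite -(ler_pXn2r (_ : (0 < 2)%N)) ?nnegrE ?mulr_ge0 ?(ltW s20) ?(ltW L0)//.
  by rewrite s22 exprMn; lra.
have q4 : 2 * s2 <= q.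
  have : q * E <= q by rewrite ler_piMr// ltW.
  by lra.
pose Q := q / s2.
have Qs2 : Q * s2 = q by rewrite /Q divfK// gt_eqF.
have Q2 : 2 <= Q by rewrite /Q ler_pdivlMr.
pose N := Num.truncn Q.
have NQ : N%:R <= Q by rewrite truncn_le; lra.
have QN : Q / 2 <= N%:R by have := truncnS_gt Q; rewrite -/N -natr1; lra.
have N0 : (0 < N)%N by rewrite -(ltr_nat R); lra.
exists N.-1; rewrite prednK//; split.
  rewrite natrM natrX -mul2n natrM -s22 -q2 -Qs2 exprMn.
  rewrite ler_wpM2r ?sqr_ge0// ler_pXn2r ?nnegrE ?ler0n//.
  by apply: le_trans Q2.
have ssp : 0 < s2 * sM by rewrite mulr_gt0.
rewrite -(ler_pM2r ssp).
have h1 : q / 2 <= N%:R * s2.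
  by rewrite -Qs2 mulrAC ler_pM2r.
have h3 : q / 2 * E <= (N%:R * s2) * (p * sM).
  by apply: ler_pM => //; [rewrite divr_ge0// ltW | exact: ltW].
have h4 : L * (s2 * sM) <= L * (10 / 7 * (L ^+ 2 + 1)).
  by rewrite ler_wpM2l ?(ltW L0)//; lra.
have -> : N%:R * p * (s2 * sM) = (N%:R * s2) * (p * sM) by lra.
apply: le_trans h3; apply: (le_trans h4).
have -> : q / 2 * E = (q * E) / 2 by lra.
by move: qL L3 LL; move: (q * E) => qE' *; lra.
Qed.

(** Here [2 * expR (- 2 * eps ^+ 2) = expR (- L^-1)], which is below
    [(1 + L^-1)^-1 = 1 - (1 + L)^-1], while [expR (- L) <= (1 + L)^-1]. *)
Lemma epsilon_near_half_ln2 L : 0 < L -> exists eps : R,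
  [/\ 0 < eps, eps ^+ 2 = (ln 2 + L^-1) / 2 &
    2 * expR (- 2 * eps ^+ 2) < 1 - expR (- L)].
Proof.
move=> L0; have l2 := @ln2_gt0 R.
have iL0 : 0 < L^-1 by rewrite invr_gt0.
exists (Num.sqrt ((ln 2 + L^-1) / 2)); rewrite sqr_sqrtr; last by lra.
split => //; first by rewrite sqrtr_gt0; lra.
have -> : - 2 * ((ln 2 + L^-1) / 2) = - ln 2 + - L^-1 :> R by lra.
rewrite expRD expRN lnK ?posrE// mulrA mulfV// mul1r.
have L1 : 0 < 1 + L by lra.
have h1 : expR (- L) <= (1 + L)^-1.
  by rewrite expRN lef_pV2 ?posrE ?expR_gt0//; exact: expR_ge1Dx.
apply: (@lt_le_trans _ _ (1 + L^-1)^-1).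
  rewrite [ltLHS]expRN ltf_pV2 ?posrE ?expR_gt0//; last lra.
  by apply: expR_gt1Dx; rewrite gt_eqF.
suff -> : (1 + L^-1)^-1 = 1 - (1 + L)^-1 by rewrite lerD2l lerN2.
have -> : 1 + L^-1 = (1 + L) / L by rewrite mulrDl mul1r mulfV ?gt_eqF// addrC.
have : (1 + L) * (1 + L)^-1 = 1 by rewrite mulfV// gt_eqF.
by rewrite invf_div; set v := (1 + L)^-1; lra.
Qed.

Lemma card_balanced_double_le (M' H : nat) : (0 < H)%N -> (H <= M'.+1)%N ->
  #|@balanced R M'.*2.+1 H.*2|%:R / 2 ^+ M'.*2.+2 <=
    1 - 2 * 'C(M'.+1.*2, M'.+1 + H)%:R / 2 ^+ M'.+1.*2 :> R.
Proof.
by move=> H0 HM; rewrite doubleS; apply: card_balanced_le; lia.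
Qed.

(** After squaring and dividing by [M], the excess of [eps ^+ 2] over [ln 2 / 2] costs
    [B ^+ 2 / L <= 25 / 34], and rounding [T] down costs [2 * T / M <= 1 / 5]. With the [3 / 2] in
    [k] these sum to less than [61 / 25]. *)
Lemma radius_le (B y L eps k M T H : R) : 0 <= B -> B <= y -> 0 < L ->
  2 * ln 2 * y ^+ 2 = L -> k = L / 2 - 3 * ln L - 3 / 2 ->
  3 * ln L + 61 / 25 <= ln 2 * (y ^+ 2 - B ^+ 2) ->
  0 <= eps -> eps ^+ 2 = (ln 2 + L^-1) / 2 ->
  0 <= M -> 0 <= T -> T ^+ 2 = M * k -> T <= M / 10 -> 0 <= H -> T < H + 1 ->
  B * eps * Num.sqrt (2 * M) <= H.
Proof.
move=> B0 By L0 yL kE cond e0 eps2 M0 T0 T2 TM H0 TH.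
have iL0 : 0 < L^-1 by rewrite invr_gt0.
have LiL : L * L^-1 = 1 by rewrite mulfV// gt_eqF.
have l2' := @ln2_ge R.
have BBy : B ^+ 2 <= y ^+ 2 by rewrite ler_pXn2r// ?nnegrE// (le_trans B0).
have BL : B ^+ 2 * L^-1 <= 25 / 34.
  have h1 : B ^+ 2 * L^-1 <= y ^+ 2 * L^-1 by rewrite ler_wpM2r// ltW.
  have y2L : 0 <= y ^+ 2 * L^-1 by rewrite mulr_ge0 ?sqr_ge0// ltW.
  have h2 : 17 / 25 * (y ^+ 2 * L^-1) <= ln 2 * (y ^+ 2 * L^-1) by rewrite ler_wpM2r.
  have h3 : 2 * (ln 2 * (y ^+ 2 * L^-1)) = 1.
    by rewrite -[RHS]LiL -[X in _ = X * _]yL !mulrA.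
  by lra.
have HT2 : T ^+ 2 - 2 * T <= H ^+ 2.
  have [T1|T1] := leP 1 T; last by have := sqr_ge0 H; nra.
  have : (T - 1) ^+ 2 <= H ^+ 2 by rewrite ler_pXn2r ?nnegrE//; lra.
  by lra.
have LE : L / 2 = ln 2 * y ^+ 2 by rewrite -[in LHS]yL; lra.
have key : B ^+ 2 * ln 2 + B ^+ 2 * L^-1 <= k - 1 / 5 by rewrite kE LE; lra.
rewrite -(ler_pXn2r (_ : (0 < 2)%N)) ?nnegrE ?mulr_ge0 ?sqrtr_ge0//.
rewrite !exprMn eps2 sqr_sqrtr ?mulr_ge0//.
have h := ler_wpM2r M0 key.
apply: le_trans HT2; rewrite T2.
have -> : B ^+ 2 * ((ln 2 + L^-1) / 2) * (2 * M) =
  (B ^+ 2 * ln 2 + B ^+ 2 * L^-1) * M by lra.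
by apply: (le_trans h); lra.
Qed.

Lemma sqrt_opt_ge_large x B : 1 < x -> 8 <= Num.sqrt (log4 x) ->
  0 <= B -> B <= Num.sqrt (log4 x) ->
  3 * ln (ln x) + 61 / 25 <= ln 2 * (Num.sqrt (log4 x) ^+ 2 - B ^+ 2) ->
  B <= Num.sqrt (opt_adjustment x).
Proof.
move=> x1; have lnL := @ln_ln_le R x x1; have yL := log4_sqr x1.
have L0 := ln_gt0_x x1; set L := ln x in lnL yL L0 *.
move: lnL yL; set y := Num.sqrt (log4 x) => lnL yL y8 B0 By cond.
have {}lnL := lnL y8.
have l2 := @ln2_le R; have l2' := @ln2_ge R.
have L5 : 10 * y <= L.
  have yy : 8 * y <= y ^+ 2 by rewrite expr2 ler_wpM2r//; lra.
  have : 17 / 25 * y ^+ 2 <= ln 2 * y ^+ 2 by rewrite ler_wpM2r ?sqr_ge0.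
  by rewrite -yL; lra.
have L87 : 87 <= L.
  have yy : 8 * 8 <= y ^+ 2 by rewrite expr2 ler_pM//; lra.
  have : 17 / 25 * y ^+ 2 <= ln 2 * y ^+ 2 by rewrite ler_wpM2r ?sqr_ge0.
  by rewrite -yL; lra.
pose k := L / 2 - 3 * ln L - 3 / 2.
have lnL0 : 0 <= ln L by rewrite ln_ge0//; lra.
have k20 : 20 <= k by rewrite /k; lra.
have kL : k <= L / 2 by rewrite /k; lra.
have k0 : 0 <= k by lra.
have k2 : k ^+ 2 <= L / 2 * (L / 2) by rewrite expr2 ler_pM.
(* [M] of order [L ^+ 2] keeps the binomial tail Gaussian at shifts near [sqrt (M * k)], as
   [k <= L / 2], and costs only multiples of [ln L] in the exponent. *)
pose M' := Num.truncn (L ^+ 2); pose M := M'.+1.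
have Mgt : L ^+ 2 < M%:R by exact: truncnS_gt.
have Mle : M%:R <= L ^+ 2 + 1 by rewrite -natr1 lerD2r truncn_le sqr_ge0.
have M0 : 0 < M%:R :> R by rewrite ltr0n.
have LL : 87 * L <= L ^+ 2 by rewrite expr2 ler_wpM2r// ltW.
pose T := Num.sqrt (M%:R * k).
have T0 : 0 <= T by exact: sqrtr_ge0.
have T2 : T ^+ 2 = M%:R * k by rewrite sqr_sqrtr// mulr_ge0// ltW.
have TM : T <= M%:R / 10.
  rewrite -(ler_pXn2r (_ : (0 < 2)%N)) ?nnegrE ?divr_ge0 ?(ltW M0)// T2.
  have -> : (M%:R / 10) ^+ 2 = M%:R * (M%:R / 100) :> R by lra.
  by rewrite ler_wpM2l ?(ltW M0)//; lra.
(* The largest integer shift with [H ^ 2 / M <= k]. *)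
pose H := Num.truncn T.
have HT : H%:R <= T by rewrite truncn_le.
have TH : T < H%:R + 1 by rewrite natr1 truncnS_gt.
have H0 : 0 <= H%:R :> R by exact: ler0n.
have H1 : (0 < H)%N.
  rewrite truncn_gt0 -(ler_pXn2r (_ : (0 < 2)%N)) ?nnegrE// T2 expr1n.
  have : 1 * 20 <= M%:R * k by rewrite ler_pM// ler1n.
  by lra.
have HM : (H < M)%N by rewrite -(ltr_nat R); lra.
have H2 : H%:R ^+ 2 <= M%:R * k by rewrite -T2 ler_pXn2r ?nnegrE.
have kM : 7 * k ^+ 2 + 2 * k <= 2 * M%:R by lra.
have Mk : 0 < M%:R - k by lra.
have bin := shifted_binomial_ge HM Mk H2 kM.
pose p : R := 2 * 'C(M.*2, M + H)%:R / 2 ^+ M.*2.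
have [N [Nx Np]] := @exists_row_count x L k p M x1 erefl L87 erefl k0 Mgt Mle bin.
have [eps [eps0 eps2 epsL]] := epsilon_near_half_ln2 L0.
apply: (@sqrt_opt_ge _ M'.*2.+1 N H.*2 x eps B) => //.
- have bal : #|@balanced R M'.*2.+1 H.*2|%:R / 2 ^+ M'.*2.+2 <= 1 - p :> R.
    by apply: card_balanced_double_le => //; exact: ltnW.
  have bal0 : 0 <= #|@balanced R M'.*2.+1 H.*2|%:R / 2 ^+ M'.*2.+2 :> R.
    by rewrite divr_ge0 ?exprn_ge0.
  have h := le_expR_pow N.+1 bal0 bal.
  apply: (lt_le_trans epsL); rewrite lerD2l lerN2 (le_trans h)//.
  by rewrite ler_expR lerN2.
- have -> : H.*2%:R / 2 = H%:R :> R by rewrite -muln2 natrM mulfK.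
  have -> : (M'.*2.+2)%:R = 2 * M%:R :> R by rewrite -doubleS -mul2n natrM.
  exact: (radius_le B0 By L0 yL erefl cond (ltW eps0) eps2 (ltW M0) T0 T2 TM H0 TH).
Qed.

End large_sample.

(** * The two lower bounds and the conclusion *)

Section lower_bound_final.
Context {R : realType}.
Variables (x : R) (x1 : 1 < x).
Local Notation L := (ln x).
Local Notation l := (@ln R 2).
Local Notation y := (Num.sqrt (log4 x)).

(** Unanimous votes serve up to [y = 8], binomial tails beyond; [rho <= 2] lets 4 stand for
    [rho ^+ 2] in [y ^+ 2 - (y - rho) ^+ 2]. *)
Lemma sqrt_opt_ge_sub rho : 0 <= rho -> rho <= y -> rho <= 2 ->
  (y <= 8 -> 2 <= rho \/ (17 / 10 <= rho /\ 14 / 5 < y)) ->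
  (8 <= y -> 3 * ln L + 61 / 25 <= l * (2 * (rho * y) - 4)) ->
  y - rho <= Num.sqrt (opt_adjustment x).
Proof.
move=> rho0 rhoy rho2 hsmall hlarge.
have [y8|/ltW y8] := leP y 8.
  by apply: sqrt_opt_ge_small => //; exact: hsmall.
apply: sqrt_opt_ge_large => //; [lra|lra|].
apply: (le_trans (hlarge y8)); rewrite ler_wpM2l ?(ltW ln2_gt0)//.
have : rho ^+ 2 <= 2 ^+ 2 by rewrite ler_pXn2r ?nnegrE.
by lra.
Qed.

Lemma sqrt_opt_ge_2 : y - 2 <= Num.sqrt (opt_adjustment x).
Proof.
have [y2|/ltW y2] := leP y 2; first by rewrite (le_trans _ (sqrtr_ge0 _))//; lra.
apply: sqrt_opt_ge_sub => //; first by left.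
move=> y8; have := ln_ln_le x1 y8; have := @ln2_ge R; have := @ln2_le R => l2 l2' lnL.
have : 17 / 25 * (2 * (2 * y) - 4) <= l * (2 * (2 * y) - 4).
  by rewrite ler_wpM2r//; lra.
by lra.
Qed.

Lemma sqrt_opt_ge_loglog : 2 * ln (expR 1 + L) <= Num.sqrt L ->
  y - 4 * ln (expR 1 + L) / Num.sqrt L <= Num.sqrt (opt_adjustment x).
Proof.
have e2 := @expR1_ge2 R; have L0 := ln_gt0_x x1; have y0 := sqrt_log4_ge0 x.
have l2 := @ln2_le R; have l2' := @ln2_ge R; have yL := log4_sqr x1.
set ll := ln (expR 1 + L); set s := Num.sqrt L => lls.
have s2 : s ^+ 2 = L by rewrite sqr_sqrtr// ltW.
have s0 : 0 < s by rewrite sqrtr_gt0.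
have lnle (u : R) : 0 < u -> u <= expR 1 + L -> ln u <= ll.
  by move=> u0 uL; rewrite ler_ln ?posrE//; lra.
have l4 : ln 4 = 2 * l :> R by exact: ln4E.
have l8 : ln 8 = 3 * l :> R by exact: ln8E.
(* The hypothesis [2 * ll <= s] bootstraps: each lower bound on [ll] raises the one on [L = s ^+ 2],
   which in turn improves [ll], until [4 <= s]. *)
have ll1 : 1 <= ll by rewrite -[leLHS]expRK ler_ln ?posrE; lra.
have sq (a : R) : 0 <= a -> a <= s -> a * a <= L.
  by move=> a0 as_; rewrite -s2 expr2 ler_pM.
have L4 : 4 <= L by have := sq 2; lra.
have ll4 : 34 / 25 <= ll by have := lnle 4; lra.
have L7 : 7 <= L by have := sq (68 / 25); lra.
have ll8 : 51 / 25 <= ll by have := lnle 8; lra.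
have s4 : 4 <= s by lra.
set rho := 4 * ll / s.
have rsL : rho * s = 4 * ll by rewrite /rho divfK// gt_eqF.
have rho0 : 0 < rho by rewrite /rho divr_gt0//; lra.
have rho2 : rho <= 2 by rewrite /rho ler_pdivrMr//; lra.
have sy : s <= 6 / 5 * y.
  have sL00 := ltW s0; have y60 : 0 <= 6 / 5 * y by lra.
  rewrite -(ler_pXn2r (_ : (0 < 2)%N)) ?nnegrE//.
  have : l * y ^+ 2 <= 7 / 10 * y ^+ 2 by rewrite ler_wpM2r ?sqr_ge0.
  by rewrite s2 -yL exprMn; have := sqr_ge0 y; lra.
have ry : 10 / 3 * ll <= rho * y.
  have := ler_wpM2l (ltW rho0) sy; rewrite rsL; lra.
have lns : 2 * ln s <= ll.
  have -> : 2 * ln s = ln L by rewrite -s2 lnXn// mulr_natl.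
  by apply: lnle; lra.
apply: sqrt_opt_ge_sub; [lra|lra|lra| |].
- move=> y8; right; split; last by lra.
  have s95 : s <= 19 / 2.
    have yy : y ^+ 2 <= 8 ^+ 2 by rewrite ler_pXn2r ?nnegrE.
    have ly : l * y ^+ 2 <= 7 / 10 * y ^+ 2 by rewrite ler_wpM2r ?sqr_ge0.
    rewrite -(ler_pXn2r (_ : (0 < 2)%N)) ?nnegrE ?(ltW s0)// s2 -yL.
    by lra.
  have hl := linear_le_ln s4 s95.
  by rewrite -(ler_pM2r s0) rsL; lra.
- move=> y8.
  have L64 : 64 <= L.
    have yy : 8 * 8 <= y ^+ 2 by rewrite expr2 ler_pM.
    have : 17 / 25 * y ^+ 2 <= l * y ^+ 2 by rewrite ler_wpM2r ?sqr_ge0.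
    by rewrite -yL; lra.
  have ll64 : 4 <= ll.
    have : ln (8 * 8) <= ll by apply: lnle; lra.
    by rewrite lnM ?posrE// l8; lra.
  have lL : ln L <= ll by apply: lnle; lra.
  have h1 : 17 / 25 * (rho * y) <= l * (rho * y) by rewrite ler_wpM2r// mulr_ge0//; lra.
  by lra.
Qed.

End lower_bound_final.

Theorem theorem1 (R : realType) (x : R) (hx : 1 < x) :
  `|Num.sqrt (opt_adjustment x) - Num.sqrt (log4 x)|
    <= 2 * Num.min 1 (2 * ln (expR 1 + ln x) / Num.sqrt (ln x)).
Proof.
have L0 := ln_gt0_x hx.
have sL0 : 0 < Num.sqrt (ln x) by rewrite sqrtr_gt0.
set t := 2 * ln (expR 1 + ln x) / Num.sqrt (ln x).
have [t1|/ltW t1] := leP 1 t.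
  have := sqrt_opt_le_2 hx; have := sqrt_opt_ge_2 hx.
  by rewrite ler_norml; lra.
have h : 2 * ln (expR 1 + ln x) <= Num.sqrt (ln x).
  by rewrite -[leRHS]mul1r -ler_pdivrMr.
have tE : 4 * ln (expR 1 + ln x) / Num.sqrt (ln x) = 2 * t by rewrite /t; lra.
have := sqrt_opt_le_loglog hx h; have := sqrt_opt_ge_loglog hx h.
by rewrite tE ler_norml; lra.
Qed.
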